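(* Let $n\ge 1$. The following assertions are equivalent for an alternating sign matrix $A$ of order $n$: (i) $A$ is the permutation matrix of a covexillary permutation; (ii) $A$ does not have two ascents $(i,j)$ and $(k,\ell)$ such that $i<k$ and $j>\ell$; (iii) $\varepsilon_A$ is well-defined and forms a depth antichain of $\mathcal{D}_n$; (iv) $\varepsilon_A$ is well-defined and extends to a depth triangle of order $n$; (v) there exists a wall of order $n$ containing $\mathrm{m}(A)$; (vi) there exists a catalan congruence of $\mathbf{ASM}_n$ such that $A$ is maximal in its class.
   Context: An alternating sign matrix (ASM) of order $n$ is an $n\times n$ matrix $A$ with entries in $\{-1,0,1\}$, all row and column sums $1$, and whose nonzero entries alternate in sign in each row and column. Its height function matrix (HFM) is $H_{i,j}=i+j-2\sum_{i'\le i,j'\le j}A_{i',j'}$, $0\le i,j\le n$. $\mathbf{ASM}_n$ is the set of ASMs of order $n$ ordered by entrywise comparison of HFMs; it is a distributive lattice. A pair $(i,j)$ with $0<i,j<n$ is an ascent of $A$ if there is an ASM $A'$ whose HFM $H'$ satisfies $H'_{i,j}=H_{i,j}+2$ and $H'_{k,\ell}=H_{k,\ell}$ for all $(k,\ell)\neq(i,j)$. The permutation matrix of $\sigma$ has entries $\delta_{\sigma(i),j}$. A permutation is covexillary if it avoids the pattern $3412$. Tetrahedron poset $\mathcal{T}_n$: quadruples $\mathbf{x}=(x_1,x_2,x_3,x_4)\in\mathbb{N}^4$ with $x_1+x_2+x_3+x_4=n-2$, ordered by $\mathbf{x}\le\mathbf{y}$ iff $x_1\ge y_1$, $x_2\le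 y_2$, $x_3\le y_3$, $x_4\ge y_4$. It is isomorphic to the poset of join irreducible elements of $\mathbf{ASM}_n$ via $\mathbf{x}\mapsto j(\mathbf{x})$, where $j(\mathbf{x})$ is the permutation matrix of block form $$j(\mathbf{x})=\begin{pmatrix} I_{x_1}&0&0&0\\0&0&I_{x_2+1}&0\\0&I_{x_3+1}&0&0\\0&0&0&I_{x_4}\end{pmatrix}.$$ An ASM $A$ corresponds to the lower set $\mathrm{J}(A)=\{\mathbf{x}\in\mathcal{T}_n \mid j(\mathbf{x})\le A\}$ of $\mathcal{T}_n$ and to the complementary upper set $\mathcal{T}_n\setminus \mathrm{J}(A)$. $\mathrm{m}(A)$ denotes the antichain of $\mathcal{T}_n$ generating the upper set corresponding to $A$, i.e. the set of minimal elements of $\mathcal{T}_n\setminus\mathrm{J}(A)$. Triangular poset $\mathcal{D}_n$: triples $(y_1,y_2,y_3)\in\mathbb{N}^3$ with $y_1+y_2+y_3=n-2$, ordered by $(y_1,y_2,y_3)\le(z_1,z_2,z_3)$ iff $y_1+y_2\le z_1+z_2$ and $y_2+y_3\le z_2+z_3$. A wall of order $n$ is an (induced) subposet of $\mathcal{T}_n$ isomorphic to $\mathcal{D}_n$. Let $\bar{\mathrm{m}}(A)$ be the image of $\mathrm{m}(A)$ under the projection $(x_1,x_2,x_3,x_4)\mapsto(x_1,x_2+x_3,x_4)$, and let $\varepsilon_A:\bar{\mathrm{m}}(A)\to\mathbb{Z}$ be given by $\varepsilon_A(x_1,x_2+x_3,x_4)=x_3-x_2$ for $(x_1,x_2,x_3,x_4)\in\mathrm{m}(A)$;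 it is well-defined when the projection is injective on $\mathrm{m}(A)$. A depth triangle of order $n$ is a map $\delta:\mathcal{D}_n\to\mathbb{Z}$ with $\delta(i,0,n-2-i)=0$ for $0\le i\le n-2$, and $|\delta(y_1,y_2,y_3)-\delta(y_1,y_2-1,y_3+1)|=1=|\delta(y_1,y_2,y_3)-\delta(y_1+1,y_2-1,y_3)|$ for all $(y_1,y_2,y_3)\in\mathcal{D}_n$ with $y_2\ge1$. A depth antichain of $\mathcal{D}_n$ is a map $\varepsilon:B\to\mathbb{Z}$, where $B$ is a (possibly empty) antichain of $\mathcal{D}_n$, such that $-y_2\le\varepsilon(\mathbf{y})\le y_2$ and $\varepsilon(\mathbf{y})\equiv y_2 \pmod 2$ for all $\mathbf{y}=(y_1,y_2,y_3)\in B$, and $|\varepsilon(\mathbf{y})-\varepsilon(\mathbf{z})|\le|y_1-z_1|+|y_3-z_3|$ for all $\mathbf{y},\mathbf{z}\in B$. $\mathbf{Dyck}_n$ (Stanley lattice) is the set of Dyck paths of semilength $n$ ordered by $P\le Q$ iff $P$ stays weakly below $Q$. A catalan congruence is a lattice congruence of $\mathbf{ASM}_n$ (equivalence relation compatible with $\vee$ and $\wedge$) whose quotient is isomorphic to $\mathbf{Dyck}_n$. *)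

(* Defs.v *)
From HB Require Import structures.
From mathcomp Require Import all_boot all_order all_algebra perm.
From mathcomp Require Import zify ring.

Set Implicit Arguments.
Unset Strict Implicit.
Unset Printing Implicit Defensive.

Import Order.TTheory GRing.Theory Num.Theory.
Local Open Scope ring_scope.
Local Open Scope quotient_scope.

Fact poset_display : Order.disp_t. Proof. exact: Order.Disp tt tt. Qed.

Section Alternation.

Variable n : nat.
Implicit Type v : 'rV[int]_n.

(* Two nonzero entries with only zeros strictly between them have opposite    *)
(* signs.                                                                     *)
Definition alternating v : bool :=
  [forall j : 'I_n, forall k : 'I_n,
     [&& (j < k)%N, v 0 j != 0, v 0 k != 0
       & [forall l : 'I_n, (j < l < k)%N ==> (v 0 l == 0)]]
     ==> (v 0 j * v 0 k < 0)].

Definition asm_row v : bool :=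
  [&& [forall j, v 0 j \in [:: -1; 0; 1]], \sum_j v 0 j == 1 & alternating v].

Lemma partial_sumS (f : 'I_n -> int) (i : 'I_n) :
  \sum_(j < n | (j < i.+1)%N) f j = \sum_(j < n | (j < i)%N) f j + f i.
Proof.
rewrite (bigD1 i) //= addrC; congr (_ + _); apply: eq_bigl => j.
by rewrite -val_eqE /=; lia.
Qed.

Lemma partial_sum0 (f : 'I_n -> int) : \sum_(j < n | (j < 0)%N) f j = 0.
Proof. by rewrite big_pred0. Qed.

Lemma partial_sumT (f : 'I_n -> int) : \sum_(j < n | (j < n)%N) f j = \sum_j f j.
Proof. by apply: eq_bigl => j; rewrite ltn_ord. Qed.

Lemma asm_rowP v :
  reflect (\sum_j v 0 j = 1 /\
           forall k, (k <= n)%N -> 0 <= \sum_(j < n | (j < k)%N) v 0 j <= 1)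
          (asm_row v).
Proof.
set p := fun k : nat => \sum_(j < n | (j < k)%N) v 0 j.
have pS (i : 'I_n) : p i.+1 = p i + v 0 i by exact: partial_sumS.
have p0 : p 0%N = 0 by exact: partial_sum0.
have pT : p n = \sum_j v 0 j by exact: partial_sumT.
apply: (iffP and3P) => [[/forallP vE /eqP v1 /forallP va] | [v1 pP]].
  have vE' j : v 0 j = -1 \/ v 0 j = 0 \/ v 0 j = 1.
    by have := vE j; rewrite !inE => /or3P[]/eqP ->; tauto.
  split=> // k le_kn.
  pose Z k := (forall j : 'I_n, (j < k)%N -> v 0 j = 0) /\
              (forall m, (m <= k)%N -> p m = 0).
  pose N k := exists s : int, (s = 1 \/ s = -1) /\
    (forall m, (m <= k)%N -> p m = 0 \/ p m = s) /\
    exists l : 'I_n, (l < k)%N /\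
      (forall j : 'I_n, (l < j < k)%N -> v 0 j = 0) /\
      ((v 0 l = s /\ p k = s) \/ (v 0 l = - s /\ p k = 0)).
  have ZN : forall k, (k <= n)%N -> Z k \/ N k.
    elim=> [_|q IH lt_qn].
      by left; split=> // m; rewrite leqn0 => /eqP ->.
    pose i := Ordinal lt_qn.
    have pSi : p q.+1 = p q + v 0 i := pS i.
    have {IH} [[Z1 Z2]|[s [sP [N1 [l [lt_lq [N2 N3]]]]]]] := IH (ltnW lt_qn).
      have [vi0|vi0] := eqVneq (v 0 i) 0.
        left; split=> [j|m].
          rewrite ltnS leq_eqVlt => /orP[/eqP e|]; last exact: Z1.
          by rewrite (_ : j = i) //; apply: val_inj.
        rewrite leq_eqVlt => /orP[/eqP ->|]; last exact: Z2.
        by rewrite pSi vi0 Z2.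
      right; exists (v 0 i); split; first by have := vE' i; lia.
      split=> [m|].
        rewrite leq_eqVlt => /orP[/eqP ->|lt_mq]; last by left; apply: Z2.
        by right; rewrite pSi Z2 // add0r.
      exists i; split=> //=; split=> [j|]; first lia.
      by left; rewrite pSi Z2 // add0r.
    right; exists s; split=> //.
    have [vi0|vi0] := eqVneq (v 0 i) 0.
      split=> [m|].
        rewrite leq_eqVlt => /orP[/eqP ->|]; last exact: N1.
        by rewrite pSi vi0 addr0; apply: N1.
      exists l; split; first exact: ltnW.
      rewrite pSi vi0 addr0; split=> // j.
      rewrite ltnS [X in _ && X]leq_eqVlt => /andP[lt_lj /orP[/eqP e|lt_jq]].
        by rewrite (_ : j = i) //; apply: val_inj.
      by apply: N2; rewrite lt_lj.
    have : v 0 l * v 0 i < 0.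
      have /forallP/(_ i)/implyP := va l; apply.
      apply/and4P; split=> //; first by case: N3; lia.
      by apply/forallP=> j; apply/implyP=> /N2 ->.
    move=> lt0.
    have vil : v 0 i = - v 0 l.
      have := lt0; have := vE' i; have := vE' l.
      by move=> [|[|]] -> [|[|]] ->.
    split=> [m|].
      rewrite leq_eqVlt => /orP[/eqP ->|]; last exact: N1.
      by rewrite pSi; case: N3; lia.
    exists i; split=> //=; split=> [j|]; first lia.
    by rewrite pSi; case: N3; lia.
  have [[_ Z2]|[s [sP [N1 _]]]] := ZN _ (leqnn n).
    by move: (Z2 _ (leqnn n)); rewrite pT v1.
  have s1 : s = 1 by have := N1 _ (leqnn n); rewrite pT v1; lia.
  by rewrite -/(p k); case: (N1 _ le_kn) => ->; rewrite ?s1.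
have pv (i : 'I_n) : [/\ 0 <= p i <= 1, 0 <= p i.+1 <= 1 & p i.+1 = p i + v 0 i].
  by split; [apply: pP; apply: ltnW | apply: pP | exact: pS].
split; [|by apply/eqP|].
  by apply/forallP=> j; have [] := pv j; rewrite !inE; lia.
apply/forallP=> j; apply/forallP=> k; apply/implyP=> /and4P[lt_jk vj vk /forallP z].
have pjk q : (j < q <= k)%N -> p q = p j.+1.
  elim: q => // q IH /andP[]; rewrite ltnS leq_eqVlt => /orP[/eqP -> //|lt_jq lt_qk].
  have lt_qn : (q < n)%N by apply: ltn_trans lt_qk _.
  have -> : p q.+1 = p q + v 0 (Ordinal lt_qn) := pS (Ordinal lt_qn).
  have /implyP/(_ _)/eqP -> := z (Ordinal lt_qn); last by rewrite /= lt_jq.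
  by rewrite addr0 IH // lt_jq ltnW.
have := pjk k; rewrite lt_jk leqnn => /(_ isT) e.
have [_ j2 j3] := pv j; have [k1 k2 k3] := pv k.
have : (v 0 j = 1 /\ v 0 k = -1) \/ (v 0 j = -1 /\ v 0 k = 1).
  have := pv j => -[]; lia.
by case=> -[-> ->].
Qed.

End Alternation.

Definition is_asm n (M : 'M[int]_n) : bool :=
  [forall i, asm_row (row i M)] && [forall j, asm_row (col j M)^T].

Record asm n := Asm { asm_val :> 'M[int]_n; _ : is_asm asm_val }.
HB.instance Definition _ n := [isSub for @asm_val n].
HB.instance Definition _ n := [Choice of asm n by <:].

(* Row i' of the text (1 <= i' <= n) is the ordinal i' - 1, whence i' < i.    *)
Definition corner_sum n (M : 'M[int]_n) (i j : nat) : int :=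
  \sum_(i' < n | (i' < i)%N) \sum_(j' < n | (j' < j)%N) M i' j'.

Definition hfm n (M : 'M[int]_n) : 'M[int]_n.+1 :=
  \matrix_(i, j) (i%:Z + j%:Z - 2 * corner_sum M i j).

Definition hfm_le n (M N : 'M[int]_n) : bool :=
  [forall i, forall j, hfm M i j <= hfm N i j].

Section AsmLattice.

Variable n : nat.
Implicit Types (M : 'M[int]_n) (A B : asm n) (c : nat -> nat -> int).

Lemma corner_sumE M (i j : 'I_n) :
  M i j = corner_sum M i.+1 j.+1 - corner_sum M i.+1 j
          - corner_sum M i j.+1 + corner_sum M i j.
Proof. by rewrite /corner_sum !partial_sumS; ring. Qed.

Definition corner_spec c : Prop :=
  [/\ forall i, (i <= n)%N -> c i 0%N = 0 /\ c i n = i%:Z,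
      forall j, (j <= n)%N -> c 0%N j = 0 /\ c n j = j%:Z,
      forall i j, (i < n)%N -> (j <= n)%N -> 0 <= c i.+1 j - c i j <= 1
    & forall i j, (i <= n)%N -> (j < n)%N -> 0 <= c i j.+1 - c i j <= 1].

Lemma corner_sum_rowS M (i : 'I_n) j :
  corner_sum M i.+1 j = corner_sum M i j + \sum_(b < n | (b < j)%N) M i b.
Proof. exact: partial_sumS. Qed.

Lemma corner_sum_colS M i (j : 'I_n) :
  corner_sum M i j.+1 = corner_sum M i j + \sum_(a < n | (a < i)%N) M a j.
Proof.
by rewrite /corner_sum -big_split /=; apply: eq_bigr => a _; rewrite partial_sumS.
Qed.

Lemma corner_sum0l M j : corner_sum M 0 j = 0.
Proof. exact: partial_sum0. Qed.

Lemma corner_sum0r M i : corner_sum M i 0 = 0.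
Proof. by rewrite /corner_sum big1 // => a _; rewrite partial_sum0. Qed.

Lemma asm_corner_spec M : is_asm M -> corner_spec (corner_sum M).
Proof.
move=> /andP[/forallP rM /forallP cM].
have r i : \sum_j M i j = 1 /\
    forall k, (k <= n)%N -> 0 <= \sum_(j < n | (j < k)%N) M i j <= 1.
  have /asm_rowP[r1 r2] := rM i; split.
    by rewrite -r1; apply: eq_bigr => j _; rewrite mxE.
  move=> k /r2; rewrite (eq_bigr (M i)) // => j _; by rewrite mxE.
have d j : \sum_i M i j = 1 /\
    forall k, (k <= n)%N -> 0 <= \sum_(i < n | (i < k)%N) M i j <= 1.
  have /asm_rowP[r1 r2] := cM j; split.
    by rewrite -r1; apply: eq_bigr => i _; rewrite !mxE.
  move=> k /r2; rewrite (eq_bigr (M^~ j)) // => i _; by rewrite !mxE.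
have rS i j (lt_in : (i < n)%N) := corner_sum_rowS M (Ordinal lt_in) j.
have cS i j (lt_jn : (j < n)%N) := corner_sum_colS M i (Ordinal lt_jn).
split=> [i|j|i j lt_in le_jn|i j le_in lt_jn].
- rewrite corner_sum0r; split=> //; elim: i H => [|i IH] lt_in.
    by rewrite corner_sum0l.
  by rewrite (rS i n lt_in) IH 1?ltnW // partial_sumT (r _).1; lia.
- rewrite corner_sum0l; split=> //; elim: j H => [|j IH] lt_jn.
    by rewrite corner_sum0r.
  by rewrite (cS n j lt_jn) IH 1?ltnW // partial_sumT (d _).1; lia.
- by rewrite (rS i j lt_in) addrC addKr; apply: (r _).2.
- by rewrite (cS i j lt_jn) addrC addKr; apply: (d _).2.
Qed.

Definition mx_of_corner c : 'M[int]_n :=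
  \matrix_(i, j) (c i.+1 j.+1 - c i.+1 j - c i j.+1 + c i j).

Lemma mx_of_corner_row c (i : 'I_n) j : corner_spec c -> (j <= n)%N ->
  \sum_(b < n | (b < j)%N) mx_of_corner c i b = c i.+1 j - c i j.
Proof.
move=> [c1 c2 c3 c4]; elim: j => [_|j IH lt_jn].
  by rewrite partial_sum0 (c1 i.+1 _).1 // (c1 i _).1 // ltnW.
rewrite (partial_sumS _ (Ordinal lt_jn)) /= (IH (ltnW lt_jn)) mxE /=; lia.
Qed.

Lemma mx_of_corner_col c i (j : 'I_n) : corner_spec c -> (i <= n)%N ->
  \sum_(a < n | (a < i)%N) mx_of_corner c a j = c i j.+1 - c i j.
Proof.
move=> [c1 c2 c3 c4]; elim: i => [_|i IH lt_in].
  by rewrite partial_sum0 (c2 j.+1 _).1 // (c2 j _).1 // ltnW.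
rewrite (partial_sumS _ (Ordinal lt_in)) /= (IH (ltnW lt_in)) mxE /=; lia.
Qed.

Lemma mx_of_cornerK c i j : corner_spec c -> (i <= n)%N -> (j <= n)%N ->
  corner_sum (mx_of_corner c) i j = c i j.
Proof.
move=> cP + le_jn; elim: i => [_|i IH lt_in].
  by rewrite corner_sum0l; case: cP => _ /(_ _ le_jn)[].
rewrite (corner_sum_rowS _ (Ordinal lt_in)) mx_of_corner_row // (IH (ltnW lt_in)) /=.
lia.
Qed.

Lemma mx_of_corner_asm c : corner_spec c -> is_asm (mx_of_corner c).
Proof.
move=> cP; have [c1 c2 c3 c4] := cP.
apply/andP; split; apply/forallP=> i; apply/asm_rowP.
  have e k : \sum_(b < n | (b < k)%N) row i (mx_of_corner c) 0 b =
             \sum_(b < n | (b < k)%N) mx_of_corner c i b.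
    by apply: eq_bigr => b _; rewrite !mxE.
  rewrite -partial_sumT e mx_of_corner_row // (c1 i.+1 _).2 // (c1 i _).2 1?ltnW //.
  by split=> [|k le_kn]; [lia | rewrite e mx_of_corner_row // c3].
have e k : \sum_(b < n | (b < k)%N) (col i (mx_of_corner c))^T 0 b =
           \sum_(b < n | (b < k)%N) mx_of_corner c b i.
  by apply: eq_bigr => b _; rewrite !mxE.
rewrite -partial_sumT e mx_of_corner_col // (c2 i.+1 _).2 // (c2 i _).2 1?ltnW //.
by split=> [|k le_kn]; [lia | rewrite e mx_of_corner_col // c4].
Qed.

Lemma corner_spec_max c d : corner_spec c -> corner_spec d ->
  corner_spec (fun i j => Num.max (c i j) (d i j)).
Proof.
move=> [c1 c2 c3 c4] [d1 d2 d3 d4]; split=> [i /[dup]/c1[-> ->]/d1[-> ->]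
  |j /[dup]/c2[-> ->]/d2[-> ->]|i j lt_in le_jn|i j le_in lt_jn].
- by rewrite !maxxx.
- by rewrite !maxxx.
- by have := c3 i j lt_in le_jn; have := d3 i j lt_in le_jn; lia.
- by have := c4 i j le_in lt_jn; have := d4 i j le_in lt_jn; lia.
Qed.

Lemma corner_spec_min c d : corner_spec c -> corner_spec d ->
  corner_spec (fun i j => Num.min (c i j) (d i j)).
Proof.
move=> [c1 c2 c3 c4] [d1 d2 d3 d4]; split=> [i /[dup]/c1[-> ->]/d1[-> ->]
  |j /[dup]/c2[-> ->]/d2[-> ->]|i j lt_in le_jn|i j le_in lt_jn].
- by rewrite !minxx.
- by rewrite !minxx.
- by have := c3 i j lt_in le_jn; have := d3 i j lt_in le_jn; lia.
- by have := c4 i j le_in lt_jn; have := d4 i j le_in lt_jn; lia.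
Qed.

Lemma hfm_leP M N :
  reflect (forall i j, (i <= n)%N -> (j <= n)%N ->
             corner_sum N i j <= corner_sum M i j)
          (hfm_le M N).
Proof.
apply: (iffP forallP) => [le_MN i j le_in le_jn | le_MN i].
  have /forallP/(_ (inord j)) := le_MN (inord i).
  by rewrite !mxE !inordK ?ltnS //; lia.
by apply/forallP=> j; rewrite !mxE; have := le_MN i j (leq_ord i) (leq_ord j); lia.
Qed.

Definition asm_le A B : bool := hfm_le A B.

Fact asm_le_refl : reflexive asm_le.
Proof. by move=> A; apply/hfm_leP. Qed.

Fact asm_le_anti : antisymmetric asm_le.
Proof.
move=> A B /andP[/hfm_leP leAB /hfm_leP leBA]; apply/val_inj/matrixP=> i j /=.
have e k l : (k <= n)%N -> (l <= n)%N -> corner_sum A k l = corner_sum B k l.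
  by move=> k_le l_le; apply/eqP; rewrite eq_le leAB // leBA.
by rewrite (corner_sumE A) (corner_sumE B) !e // ltnW.
Qed.

Fact asm_le_trans : transitive asm_le.
Proof.
move=> B A C /hfm_leP leAB /hfm_leP leBC; apply/hfm_leP=> i j i_le j_le.
exact: le_trans (leBC _ _ i_le j_le) (leAB _ _ i_le j_le).
Qed.

HB.instance Definition _ :=
  Order.Le_isPOrder.Build poset_display (asm n)
    asm_le_refl asm_le_anti asm_le_trans.

Lemma asm_leE A B : (A <= B)%O = asm_le A B.
Proof. by []. Qed.

Lemma asm_corner A : corner_spec (corner_sum A).
Proof. exact: asm_corner_spec (valP A). Qed.

Definition asm_meet A B : asm n :=
  Asm (mx_of_corner_asm (corner_spec_max (asm_corner A) (asm_corner B))).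

Definition asm_join A B : asm n :=
  Asm (mx_of_corner_asm (corner_spec_min (asm_corner A) (asm_corner B))).

Lemma corner_sum_meet A B i j : (i <= n)%N -> (j <= n)%N ->
  corner_sum (asm_meet A B) i j = Num.max (corner_sum A i j) (corner_sum B i j).
Proof.
exact: (mx_of_cornerK (corner_spec_max (asm_corner A) (asm_corner B))).
Qed.

Lemma corner_sum_join A B i j : (i <= n)%N -> (j <= n)%N ->
  corner_sum (asm_join A B) i j = Num.min (corner_sum A i j) (corner_sum B i j).
Proof.
exact: (mx_of_cornerK (corner_spec_min (asm_corner A) (asm_corner B))).
Qed.

Fact asm_meetP A B C : (A <= asm_meet B C)%O = (A <= B)%O && (A <= C)%O.
Proof.
apply/hfm_leP/andP=> [leA|[/hfm_leP leAB /hfm_leP leAC] i j i_le j_le].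
  split; apply/hfm_leP=> i j i_le j_le; have := leA i j i_le j_le;
  by rewrite corner_sum_meet // ge_max => /andP[].
by rewrite corner_sum_meet // ge_max leAB // leAC.
Qed.

Fact asm_joinP A B C : (asm_join A B <= C)%O = (A <= C)%O && (B <= C)%O.
Proof.
apply/hfm_leP/andP=> [leA|[/hfm_leP leAB /hfm_leP leAC] i j i_le j_le].
  split; apply/hfm_leP=> i j i_le j_le; have := leA i j i_le j_le;
  by rewrite corner_sum_join // le_min => /andP[].
by rewrite corner_sum_join // le_min leAB // leAC.
Qed.

HB.instance Definition _ :=
  Order.POrder_MeetJoin_isLattice.Build poset_display (asm n)
    asm_meetP asm_joinP.

End AsmLattice.

Definition covexillary n (s : 'S_n) : Prop :=
  ~ exists a b c d : 'I_n,
      [/\ (a < b)%N, (b < c)%N & (c < d)%N] /\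
      [/\ (s c < s d)%N, (s d < s a)%N & (s a < s b)%N].

Definition ascent n (A : asm n) (i j : 'I_n.+1) : Prop :=
  [/\ (0 < i < n)%N, (0 < j < n)%N
    & exists A' : asm n,
        hfm A' i j = hfm A i j + 2 /\
        forall k l, (k, l) <> (i, j) -> hfm A' k l = hfm A k l].

(* The condition x1 + x2 + x3 + x4 = n - 2 is kept subtraction-free so that   *)
(* the poset is empty for n <= 1.                                             *)
Record tetra n := Tetra {
  tetra_val :> nat * nat * nat * nat;
  _ : (let: (x1, x2, x3, x4) := tetra_val in x1 + x2 + x3 + x4 + 2 == n)%N }.
HB.instance Definition _ n := [isSub for @tetra_val n].
HB.instance Definition _ n := [Countable of tetra n by <:].

Definition tx1 n (x : tetra n) : nat := x.1.1.1.
Definition tx2 n (x : tetra n) : nat := x.1.1.2.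
Definition tx3 n (x : tetra n) : nat := x.1.2.
Definition tx4 n (x : tetra n) : nat := x.2.

Record triang n := Triang {
  triang_val :> nat * nat * nat;
  _ : (let: (y1, y2, y3) := triang_val in y1 + y2 + y3 + 2 == n)%N }.
HB.instance Definition _ n := [isSub for @triang_val n].
HB.instance Definition _ n := [Countable of triang n by <:].

Definition dy1 n (y : triang n) : nat := y.1.1.
Definition dy2 n (y : triang n) : nat := y.1.2.
Definition dy3 n (y : triang n) : nat := y.2.

Section Tetra.

Variable n : nat.
Implicit Types x y z : tetra n.

Lemma tetraP x : (tx1 x + tx2 x + tx3 x + tx4 x + 2 = n)%N.
Proof. by case: x => [[[[a b] c] d] xP]; apply/eqP. Qed.

Lemma tetra_inj x y :
  tx1 x = tx1 y -> tx2 x = tx2 y -> tx3 x = tx3 y -> tx4 x = tx4 y -> x = y.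
Proof.
case: x y => [[[[? ?] ?] ?] ?] [[[[? ?] ?] ?] ?].
rewrite /tx1 /tx2 /tx3 /tx4 /= => e1 e2 e3 e4.
by apply: val_inj; rewrite /= e1 e2 e3 e4.
Qed.

Definition tetra_code x : 'I_n.+1 * 'I_n.+1 * 'I_n.+1 * 'I_n.+1 :=
  (inord (tx1 x), inord (tx2 x), inord (tx3 x), inord (tx4 x)).
Definition tetra_decode (u : 'I_n.+1 * 'I_n.+1 * 'I_n.+1 * 'I_n.+1) :
    option (tetra n) :=
  insub (val u.1.1.1, val u.1.1.2, val u.1.2, val u.2).

Lemma tetra_codeK : pcancel tetra_code tetra_decode.
Proof.
move=> x; have := tetraP x; rewrite /tetra_decode /= => xP.
rewrite !inordK ?ltnS; try lia.
rewrite -[RHS](valK x) /=; congr insub.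
by case: (x) => [[[[? ?] ?] ?] ?].
Qed.

HB.instance Definition _ : isFinite (tetra n) := PCanIsFinite tetra_codeK.

Definition tetra_le x y : bool :=
  [&& tx1 y <= tx1 x, tx2 x <= tx2 y, tx3 x <= tx3 y & tx4 y <= tx4 x]%N.

Fact tetra_le_refl : reflexive tetra_le.
Proof. by move=> x; rewrite /tetra_le !leqnn. Qed.

Fact tetra_le_anti : antisymmetric tetra_le.
Proof. by move=> x y; rewrite /tetra_le => le2; apply: tetra_inj; lia. Qed.

Fact tetra_le_trans : transitive tetra_le.
Proof. by move=> y x z; rewrite /tetra_le; lia. Qed.

HB.instance Definition _ :=
  Order.Le_isPOrder.Build poset_display (tetra n)
    tetra_le_refl tetra_le_anti tetra_le_trans.

Lemma tetra_leE x y : (x <= y)%O = tetra_le x y.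
Proof. by []. Qed.

End Tetra.

Section Triang.

Variable n : nat.
Implicit Types x y z : triang n.

Lemma triangP y : (dy1 y + dy2 y + dy3 y + 2 = n)%N.
Proof. by case: y => [[[a b] c] yP]; apply/eqP. Qed.

Lemma triang_inj y z : dy1 y = dy1 z -> dy2 y = dy2 z -> dy3 y = dy3 z -> y = z.
Proof.
case: y z => [[[? ?] ?] ?] [[[? ?] ?] ?].
rewrite /dy1 /dy2 /dy3 /= => e1 e2 e3.
by apply: val_inj; rewrite /= e1 e2 e3.
Qed.

Definition triang_code y : 'I_n.+1 * 'I_n.+1 * 'I_n.+1 :=
  (inord (dy1 y), inord (dy2 y), inord (dy3 y)).
Definition triang_decode (u : 'I_n.+1 * 'I_n.+1 * 'I_n.+1) : option (triang n) :=
  insub (val u.1.1, val u.1.2, val u.2).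

Lemma triang_codeK : pcancel triang_code triang_decode.
Proof.
move=> y; have := triangP y; rewrite /triang_decode /= => yP.
rewrite !inordK ?ltnS; try lia.
rewrite -[RHS](valK y) /=; congr insub.
by case: (y) => [[[? ?] ?] ?].
Qed.

HB.instance Definition _ : isFinite (triang n) := PCanIsFinite triang_codeK.

Definition triang_le y z : bool :=
  (dy1 y + dy2 y <= dy1 z + dy2 z)%N && (dy2 y + dy3 y <= dy2 z + dy3 z)%N.

Fact triang_le_refl : reflexive triang_le.
Proof. by move=> y; rewrite /triang_le !leqnn. Qed.

Fact triang_le_anti : antisymmetric triang_le.
Proof.
move=> y z; rewrite /triang_le => le2; have := triangP y; have := triangP z.
by move=> ? ?; apply: triang_inj; lia.
Qed.

Fact triang_le_trans : transitive triang_le.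
Proof. by move=> y x z; rewrite /triang_le; lia. Qed.

HB.instance Definition _ :=
  Order.Le_isPOrder.Build poset_display (triang n)
    triang_le_refl triang_le_anti triang_le_trans.

Lemma triang_leE y z : (y <= z)%O = triang_le y z.
Proof. by []. Qed.

End Triang.

Section Antichains.

Variable n : nat.
Implicit Types (A : asm n) (x : tetra n) (y z : triang n) (B : {set triang n}).

Fact tetra_rowsE x :
  (tx1 x + (((tx2 x).+1 + (tx3 x).+1) + tx4 x) = n)%N.
Proof. by have := tetraP x; lia. Qed.

Fact tetra_colsE x :
  (tx1 x + (((tx3 x).+1 + (tx2 x).+1) + tx4 x) = n)%N.
Proof. by have := tetraP x; lia. Qed.

Definition jmx x : 'M[int]_n :=
  castmx (tetra_rowsE x, tetra_colsE x)
    (block_mx 1%:M 0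
              0    (block_mx (block_mx 0 1%:M 1%:M 0) 0
                             0                        1%:M)).

Definition jfun (a b c i : nat) : nat :=
  (if i < a then i
   else if i < a + b.+1 then i + c.+1
   else if i < a + b.+1 + c.+1 then i - b.+1
   else i)%N.

Lemma jmxE x (i j : 'I_n) :
  jmx x i j = (val j == jfun (tx1 x) (tx2 x) (tx3 x) i)%:R.
Proof.
have b0 (b : bool) : b = false -> 0 = b%:R :> int by move=> ->.
have b2 k (u v : 'I_k) (b : bool) :
  (val u == val v) = b -> (u == v)%:R = b%:R :> int by move=> <-.
have xP := tetraP x; have lt_in := ltn_ord i; have lt_jn := ltn_ord j.
rewrite castmxE /jfun /block_mx !mxE /=.
case: splitP => [i1|i1] /= iE; rewrite !mxE; case: splitP => [j1|j1] /= jE;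
  have ? := ltn_ord i1; have ? := ltn_ord j1; do ?rewrite mxE;
  [apply: b2 => /=; do ?case: ifP; lia | apply: b0; do ?case: ifP; lia.. |].
case: splitP => [i2|i2] /= iE2; rewrite !mxE; case: splitP => [j2|j2] /= jE2;
  have ? := ltn_ord i2; have ? := ltn_ord j2; do ?rewrite mxE;
  [| apply: b0; do ?case: ifP; lia.. | apply: b2 => /=; do ?case: ifP; lia].
by case: splitP => [i3|i3] /= iE3; rewrite !mxE; case: splitP => [j3|j3] /= jE3;
  have ? := ltn_ord i3; have ? := ltn_ord j3; do ?rewrite mxE;
  (apply: b2 => /=; do ?case: ifP; lia) || (apply: b0; do ?case: ifP; lia).
Qed.

Lemma unit_row_asm (v : 'rV[int]_n) (k : 'I_n) :
  (forall j, v 0 j = (j == k)%:R) -> asm_row v.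
Proof.
move=> vE; apply/asm_rowP; split=> [|q _].
  by rewrite (bigD1 k) //= vE eqxx big1 ?addr0 // => j /negPf; rewrite vE => ->.
case: (ltnP k q) => [lt_kq|le_qk].
  rewrite (bigD1 k) //= vE eqxx big1 // => j /andP[_ /negPf jk].
  by rewrite vE jk.
rewrite big1 // => j lt_jq; rewrite vE (_ : (j == k) = false) //.
by rewrite -val_eqE /=; lia.
Qed.

Fact jmx_asm x : is_asm (jmx x).
Proof.
have xP := tetraP x.
have lt_j b c (k : 'I_n) : (b + c = tx2 x + tx3 x)%N -> (jfun (tx1 x) b c k < n)%N.
  by move=> e; have := ltn_ord k; rewrite /jfun; do !case: ifP; lia.
have lt_r := lt_j (tx2 x) (tx3 x) ^~ erefl.
have lt_c := lt_j (tx3 x) (tx2 x) ^~ (addnC _ _).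
apply/andP; split; apply/forallP=> i.
  apply: (@unit_row_asm _ (Ordinal (lt_r i))) => j.
  by rewrite mxE jmxE -val_eqE.
apply: (@unit_row_asm _ (Ordinal (lt_c i))) => j.
rewrite !mxE jmxE -val_eqE /=; congr (nat_of_bool _)%:R.
have := ltn_ord i; have := ltn_ord j; rewrite /jfun; do !case: ifP; lia.
Qed.

Definition jasm x : asm n := Asm (jmx_asm x).

Definition J A : {set tetra n} := [set x | (jasm x <= A)%O].

Definition mset A : {set tetra n} :=
  [set x in ~: J A | [forall x' in ~: J A, ~~ (x' < x)%O]].

Fact proj_subproof x :
  (tx1 x + (tx2 x + tx3 x) + tx4 x + 2 == n)%N.
Proof. by apply/eqP; have := tetraP x; lia. Qed.

Definition proj x : triang n :=
  @Triang n (tx1 x, tx2 x + tx3 x, tx4 x)%N (proj_subproof x).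

Definition mbar A : {set triang n} := [set proj x | x in mset A].

(* A map defined on a subset B of triang n is represented by a total function *)
(* whose values outside B are irrelevant; eps_map A is meaningful on mbar A   *)
(* under eps_well_defined A.                                                  *)
Definition eps_map A y : int :=
  if [pick x in mset A | proj x == y] is Some x
  then (tx3 x)%:Z - (tx2 x)%:Z else 0.

Definition eps_well_defined A : Prop := {in mset A &, injective proj}.

Definition depth_triangle (delta : triang n -> int) : Prop :=
  [/\ forall y, dy2 y = 0%N -> delta y = 0,
      forall y z, dy1 z = dy1 y -> (dy2 z).+1 = dy2 y -> dy3 z = (dy3 y).+1 ->
        `|delta y - delta z| = 1
    & forall y z, dy1 z = (dy1 y).+1 -> (dy2 z).+1 = dy2 y -> dy3 z = dy3 y ->
        `|delta y - delta z| = 1].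

Definition depth_antichain B (eps : triang n -> int) : Prop :=
  [/\ {in B &, forall y z, (y <= z)%O -> y = z},
      {in B, forall y, - (dy2 y)%:Z <= eps y <= (dy2 y)%:Z},
      {in B, forall y, (eps y = (dy2 y)%:Z %[mod 2])%Z}
    & {in B &, forall y z, `|eps y - eps z| <=
         `|(dy1 y)%:Z - (dy1 z)%:Z| + `|(dy3 y)%:Z - (dy3 z)%:Z|}].

Definition is_wall (W : {set tetra n}) : Prop :=
  exists2 f : triang n -> tetra n,
    {mono f : y z / (y <= z)%O} & W = [set f y | y in [set: triang n]].

End Antichains.

Definition height (w : seq bool) (k : nat) : int :=
  \sum_(b <- take k w) (if b then 1 else -1).

(* A word of length 2n whose letter true is an up step.                       *)
Definition is_dyck n (w : n.*2.-tuple bool) : bool :=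
  [forall k : 'I_n.*2.+1, 0 <= height w k] && (height w n.*2 == 0).

Record dyck n := Dyck { dyck_val :> n.*2.-tuple bool; _ : is_dyck dyck_val }.
HB.instance Definition _ n := [isSub for @dyck_val n].
HB.instance Definition _ n := [Finite of dyck n by <:].

Section Dyck.

Variable n : nat.
Implicit Types P Q : dyck n.

Definition dyck_le P Q : bool :=
  [forall k : 'I_n.*2.+1, height P k <= height Q k].

Fact dyck_le_refl : reflexive dyck_le.
Proof. by move=> P; apply/forallP. Qed.

Fact dyck_le_anti : antisymmetric dyck_le.
Proof.
move=> P Q /andP[/forallP lePQ /forallP leQP]; apply/val_inj/val_inj => /=.
have e k : (k <= n.*2)%N -> height P k = height Q k.
  rewrite -ltnS => lt_k; apply/eqP.
  by rewrite eq_le (lePQ (Ordinal lt_k)) (leQP (Ordinal lt_k)).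
apply: (@eq_from_nth _ false) => [|k]; first by rewrite !size_tuple.
rewrite size_tuple => lt_k; have := e _ lt_k; have := e _ (ltnW lt_k).
rewrite /height !(take_nth false) ?size_tuple // !big_rcons /= => -> /addrI.
by case: (nth _ P k) (nth _ Q k) => [] [].
Qed.

Fact dyck_le_trans : transitive dyck_le.
Proof.
move=> Q P R /forallP lePQ /forallP leQR; apply/forallP=> k.
exact: le_trans (lePQ k) (leQR k).
Qed.

HB.instance Definition _ :=
  Order.Le_isPOrder.Build poset_display (dyck n)
    dyck_le_refl dyck_le_anti dyck_le_trans.

Lemma dyck_leE P Q : (P <= Q)%O = dyck_le P Q.
Proof. by []. Qed.

End Dyck.

Definition lattice_congruence d (L : latticeType d) (e : equiv_rel L) : Prop :=
  forall x x' y y' : L, e x x' -> e y y' ->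
    e (x `|` y)%O (x' `|` y')%O /\ e (x `&` y)%O (x' `&` y')%O.

Section Quotient.

Context d (L : latticeType d) (e : equiv_rel L).

Definition quot_join (X Y : {eq_quot e}) : {eq_quot e} :=
  \pi_{eq_quot e} (repr X `|` repr Y)%O.

Lemma quot_joinE (x y : L) : lattice_congruence e ->
  quot_join (\pi x) (\pi y) = \pi_{eq_quot e} (x `|` y)%O.
Proof.
move=> eP; apply/eqmodP.
have er (z : L) : e (repr (\pi_{eq_quot e} z)) z by apply/eqmodP; rewrite reprK.
by have [] := eP _ _ _ _ (er x) (er y).
Qed.

Definition quot_le (X Y : {eq_quot e}) : bool := quot_join X Y == Y.

End Quotient.

(* Between lattices, isomorphisms and order isomorphisms coincide.            *)
Definition catalan_congruence n (e : equiv_rel (asm n)) : Prop :=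
  lattice_congruence e /\
  exists2 f : {eq_quot e} -> dyck n,
    bijective f & forall X Y, (f X <= f Y)%O = quot_le X Y.

(* Main.v *)
(* Writing c for the corner sums of A, j(x) <= A means c(i, j) <= x1 at the     *)
(* point (i, j) = (x1 + x2 + 1, x1 + x3 + 1), so m(A) is in bijection with the *)
(* ascents of A, and the coordinates (x1, x2, x3, x4) of the element attached  *)
(* to (i, j) are (c - 1, i - c, j - c, n - 1 - i - j + c).  Monotonicity and   *)
(* 1-Lipschitz bounds on c turn the absence of NE/SW pairs of ascents into the *)
(* depth antichain condition, and a depth antichain extends to a depth         *)
(* triangle by the McShane formula.  From a -1 entry, or from a 3412 pattern,  *)
(* two walks on which c satisfies half of the ascent conditions go NE and SW   *)
(* until they reach ascents; this gives (ii) => (i).                           *)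
(*   Dyck paths are the lower sets of D_n: a path is the upper envelope of the *)
(* tents of the elements of its lower set.  Hence A |-> J(A) :&: W defines a   *)
(* catalan congruence for every wall W.  Conversely, for a catalan congruence  *)
(* and y in D_n, the least ASM whose class dominates the tent of y is join     *)
(* irreducible; these elements form a wall, which contains m(A) when A is      *)
(* maximal in its class, since J(A v j(x)) = J(A) + x for x in m(A).           *)

Require Import Defs.
From HB Require Import structures.
From mathcomp Require Import all_boot all_order all_algebra perm.
From mathcomp Require Import zify.

Set Implicit Arguments.
Unset Strict Implicit.
Unset Printing Implicit Defensive.

Import Order.TTheory GRing.Theory Num.Theory.
Local Open Scope ring_scope.
Local Open Scope quotient_scope.

(** * Corner sums and ascents *)

(** The implications form one cycle, and everything is read off the corner sums [c] of [A], which
    are monotone and grow by at most 1 per unit step ([corner_upper]). By [in_J], membership in J(A)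
    is a bound on [c] at one point, so m(A) is the set of ascents, and [tx3 x - tx2 x] is [j - i] at
    the ascent [(i, j)].

    In a permutation matrix, two crossing ascents exhibit a 3412 pattern. Without crossings the
    ascents form a chain from NW to SE, along which [j - i] is Lipschitz in the outer coordinates
    ([noncrossing_depth_antichain]); a McShane extension then fills the triangle. A depth triangle
    tells how to split each [dy2 y] into [tx2] and [tx3], which lifts D_n to a wall
    ([depth_triangle_wall]). Restricting J to a wall gives a map onto lower sets of D_n, that is,
    Dyck paths, and its kernel is the congruence sought ([wall_catalan], [wall_maximal]).

    To return, a catalan congruence is shown to come from a wall ([congruence_wall]). Any wall
    preserves rank and distances between outer coordinates ([wall_rank], [wall_distance]), so
    crossing ascents inside it would violate the Lipschitz bound ([wall_noncrossing]). Finally, a -1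
    entry or a 3412 pattern would create crossing ascents ([noncrossing_covexillary]). *)

Lemma corner_spec_tr n c : corner_spec n c -> corner_spec n (fun i j => c j i).
Proof. by case=> c1 c2 c3 c4; split=> // i j ? ?; [apply: c4 | apply: c3]. Qed.

Lemma corner_lipschitz n c i j i' j' : corner_spec n c ->
    (i <= i' <= n)%N -> (j <= j' <= n)%N ->
  c i j <= c i' j' <= c i j + (i' - i)%:Z + (j' - j)%:Z.
Proof.
move=> [_ _ c3 c4] /andP[/subnK <-]; rewrite addnK.
elim: (i' - i)%N => [|d IH] le_dn /andP[le_j le_jn].
  rewrite add0n in le_dn *; move: le_jn; rewrite -(subnK le_j) addnK.
  elim: (j' - j)%N => [|e IH] le_en; first by rewrite add0n; lia.
  by have := c4 i (e + j)%N le_dn le_en; have := IH (ltnW le_en); rewrite addSn; lia.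
have := c3 _ j' (le_dn : (d + i < n)%N) le_jn.
by have := IH (ltnW le_dn); rewrite le_j => /(_ le_jn); rewrite addSn; lia.
Qed.

Lemma corner_bounds n c i j : corner_spec n c -> (i <= n)%N -> (j <= n)%N ->
  [/\ 0 <= c i j, c i j <= i%:Z, c i j <= j%:Z & i%:Z + j%:Z - n%:Z <= c i j].
Proof.
move=> cP le_i le_j; have [/(_ i le_i)[ci0 cin] /(_ j le_j)[c0j cnj] _ _] := cP.
have := corner_lipschitz (i := 0) (i' := i) (j := j) (j' := j) cP.
have := corner_lipschitz (i := i) (i' := n) (j := j) (j' := j) cP.
have := corner_lipschitz (i := i) (i' := i) (j := 0) (j' := j) cP.
by rewrite ci0 c0j cnj !leqnn le_i le_j => /= *; split; lia.
Qed.

(** Compare both points with their coordinatewise minimum: by monotonicity only the moves that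
    increase a coordinate cost anything, whence the truncated differences. *)
Lemma corner_upper n c i j i' j' : corner_spec n c ->
    (i <= n)%N -> (j <= n)%N -> (i' <= n)%N -> (j' <= n)%N ->
  c i' j' <= c i j + (i' - i)%N%:Z + (j' - j)%N%:Z.
Proof.
move=> cP ? ? ? ?.
have := @corner_lipschitz n c (minn i' i) (minn j' j) i j cP.
have := @corner_lipschitz n c (minn i' i) (minn j' j) i' j' cP.
by lia.
Qed.

(* The condition under which [c i j] can be decreased by [1]. *)
Definition corner_ascent (n : nat) (c : nat -> nat -> int) (i j : nat) : Prop :=
  [/\ (0 < i < n)%N, (0 < j < n)%N,
      c i.-1 j = c i j - 1 /\ c i j.-1 = c i j - 1
    & c i.+1 j = c i j /\ c i j.+1 = c i j].

(** The hypotheses are the lower and left conditions of an ascent. If the upper one fails, they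
    persist one step north; if the right one fails, they persist one step east. The border values of
    [c] keep the walk away from the north and east sides. *)
Lemma corner_ascent_NE n c i j : corner_spec n c ->
    (i < n)%N -> (0 < j <= n)%N -> c i.+1 j = c i j -> c i j.-1 = c i j - 1 ->
  exists i' j', [/\ corner_ascent n c i' j', (i' <= i)%N & (j <= j')%N].
Proof.
move=> cP; have [c1 c2 c3 c4] := cP.
move: {-1}(i + (n - j))%N (leqnn (i + (n - j))%N) => m.
elim: m i j => [|m IH] i j le_m lt_in /andP[j_gt0 le_jn] cS cN.
  have i0 : i = 0%N by lia.
  by move: cN; rewrite i0 (c2 j le_jn).1 (c2 j.-1 _).1; lia.
case: i le_m lt_in cS cN => [|i] le_m lt_in cS cN.
  by move: cN; rewrite (c2 j le_jn).1 (c2 j.-1 _).1; lia.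
have lt_jn : (j < n)%N.
  rewrite ltn_neqAle le_jn andbT; apply/eqP=> jn.
  by move: cS; rewrite jn !(c1 _ _).2; lia.
have ub := c3 i j.-1 (ltnW lt_in) (leq_trans (leq_pred j) le_jn).
have lb := c4 i j.-1 (ltnW (ltnW lt_in)).
have vb := c3 i j (ltnW lt_in) le_jn.
rewrite prednK // in lb.
have [ci|ci] := eqVneq (c i j) (c i.+1 j).
  have [|||||i' [j' [a le_i' le_j']]] := IH i j; [lia|lia|lia|lia|have := lb _; lia|].
  by exists i', j'; split=> //; lia.
have hb := c4 i.+1 j (ltnW lt_in) lt_jn.
have hb2 := c4 i.+2 j lt_in lt_jn.
have vb2 := c3 i.+1 j.+1 lt_in lt_jn.
have [cj|cj] := eqVneq (c i.+1 j.+1) (c i.+1 j).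
  exists i.+1, j; split=> //; split=> //; first lia.
  by rewrite /=; split=> //; lia.
have [|||||i' [j' [a le_i' le_j']]] := IH i.+1 j.+1; [lia|lia|lia|lia|rewrite /=; lia|].
by exists i', j'; split=> //; lia.
Qed.

Lemma corner_ascent_tr n c i j :
  corner_ascent n (fun i j => c j i) i j -> corner_ascent n c j i.
Proof. by move=> [? ? [? ?] [? ?]]; split. Qed.

Lemma corner_ascent_SW n c i j : corner_spec n c ->
    (0 < i <= n)%N -> (j < n)%N -> c i j.+1 = c i j -> c i.-1 j = c i j - 1 ->
  exists i' j', [/\ corner_ascent n c i' j', (i <= i')%N & (j' <= j)%N].
Proof.
move=> /corner_spec_tr/(@corner_ascent_NE n _ j i) H ? ? ? ?.
have [//|//|//|//|j' [i' [/corner_ascent_tr ? ? ?]]] := H; by exists i', j'.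
Qed.

Definition crossing_ascents n c := exists i j k l,
  [/\ corner_ascent n c i j, corner_ascent n c k l, (i < k)%N & (l < j)%N].

(** * Crossing ascents, negative entries and 3412 patterns *)

Section Asm.
Variable n : nat.
Implicit Types (A B : asm n) (x y : tetra n).

Lemma corner_decr_spec c i j : corner_spec n c -> corner_ascent n c i j ->
  corner_spec n (fun k l => c k l - ((k == i) && (l == j))%:R).
Proof.
move=> [c1 c2 c3 c4] [/andP[i0 ilt] /andP[j0 jlt] [cu cl] [cd cr]].
split=> [k le_k|l le_l|k l lt_k le_l|k l le_k lt_l].
- by have := c1 k le_k; do 2 (rewrite (_ : (_ && _) = false); last lia); rewrite !subr0.
- by have := c2 l le_l; do 2 (rewrite (_ : (_ && _) = false); last lia); rewrite !subr0.
- have := c3 k l lt_k le_l; have [->|] := eqVneq l j; last by rewrite !andbF; lia.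
  rewrite !andbT; have [->|ki] := eqVneq k i.
    by rewrite cd (_ : (_ == _) = false); lia.
  have [ki'|] := eqVneq k.+1 i; last lia.
  by move: cu; rewrite -ki' /=; lia.
- have := c4 k l le_k lt_l; have [->|] := eqVneq k i; last by rewrite !andFb; lia.
  rewrite !andTb; have [->|lj] := eqVneq l j.
    by rewrite cr (_ : (_ == _) = false); lia.
  have [lj'|] := eqVneq l.+1 j; last lia.
  by move: cl; rewrite -lj' /=; lia.
Qed.

Lemma ascentP A (i j : 'I_n.+1) :
  ascent A i j <-> corner_ascent n (corner_sum A) i j.
Proof.
have cP := asm_corner A; split=> [[i_in j_in [A' [hij hkl]]] | asc].
  have [_ _ c3 c4] := cP; have [_ _ d3 d4] := asm_corner A'.
  have e : corner_sum A' i j = corner_sum A i j - 1.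
    by move: hij; rewrite !mxE; lia.
  have e' k l : (k <= n)%N -> (l <= n)%N -> (k != i :> nat) || (l != j :> nat) ->
      corner_sum A' k l = corner_sum A k l.
    move=> le_k le_l ne; have := hkl (inord k) (inord l).
    rewrite !mxE !inordK //; set P := (_ <> _) => imp; suff /imp : P by lia.
    by move=> [kE lE]; move: ne; rewrite -kE -lE !inordK // !eqxx.
  have [iS jS] : (i : nat) = i.-1.+1 /\ (j : nat) = j.-1.+1 by lia.
  split=> //.
  - have := d3 i.-1 j; have := c3 i.-1 j; have := d4 i j.-1; have := c4 i j.-1.
    rewrite -iS -jS e (e' i.-1 j) ?(e' i j.-1); lia.
  - have := d3 i j; have := c3 i j; have := d4 i j; have := c4 i j.
    rewrite e (e' i.+1 j) ?(e' i j.+1); lia.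
have dP := corner_decr_spec cP asc.
have [i_in j_in _ _] := asc; split=> //.
exists (Asm (mx_of_corner_asm dP)).
have h (k l : 'I_n.+1) : corner_sum (Asm (mx_of_corner_asm dP)) k l =
    corner_sum A k l - ((k == i) && (l == j))%:R.
  by apply: (mx_of_cornerK dP); apply: leq_ord.
split=> [|k l ne]; rewrite !mxE h ?eqxx /=; first by lia.
suff -> : (k == i) && (l == j) = false by rewrite subr0.
by apply/negP=> /andP[/eqP ki /eqP lj]; apply: ne; rewrite ki lj.
Qed.

Lemma crossing_ascentsP A :
  (exists i j k l : 'I_n.+1,
     [/\ ascent A i j, ascent A k l, (i < k)%N & (l < j)%N]) <->
  crossing_ascents n (corner_sum A).
Proof.
split=> [[i [j [k [l [/ascentP ? /ascentP ? ? ?]]]]]|[i [j [k [l [ij kl ? ?]]]]]].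
  by exists i, j, k, l.
have [? ? _ _] := ij; have [? ? _ _] := kl.
by exists (inord i), (inord j), (inord k), (inord l); split;
  rewrite ?ascentP ?inordK //; lia.
Qed.

Lemma perm_corner_row A (s : 'S_n) (i : 'I_n) j : asm_val A = perm_mx s ->
  (j <= n)%N -> corner_sum A i.+1 j = corner_sum A i j + (s i < j)%N%:R.
Proof.
move=> As le_j; rewrite corner_sum_rowS As; congr (_ + _).
under eq_bigr do rewrite !mxE.
case: ltnP => [lt|le].
  by rewrite (bigD1 (s i)) //= eqxx big1 // => b /andP[_ /negPf]; rewrite eq_sym => ->.
by rewrite big1 // => b lt; case: eqP => // sb; move: le; rewrite sb leqNgt lt.
Qed.

Lemma perm_corner_col A (s : 'S_n) i (j : 'I_n) : asm_val A = perm_mx s ->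
  (i <= n)%N -> corner_sum A i j.+1 = corner_sum A i j + ((s^-1)%g j < i)%N%:R.
Proof.
move=> As le_i; rewrite corner_sum_colS As; congr (_ + _).
under eq_bigr do rewrite !mxE.
case: ltnP => [lt|le].
  rewrite (bigD1 ((s^-1)%g j)) //= permKV eqxx big1 // => a /andP[_ /negPf ne].
  by case: eqP => // sa; rewrite -sa permK eqxx in ne.
by rewrite big1 // => a lt; case: eqP => // sa; move: le; rewrite -sa permK leqNgt lt.
Qed.

Lemma corner_ascent_perm A (s : 'S_n) i j : asm_val A = perm_mx s ->
  corner_ascent n (corner_sum A) i j ->
  exists a a' b b' : 'I_n, [/\ i = a.+1, i = a' :> nat, j = b.+1 & j = b' :> nat] /\
   [/\ (s a < j)%N, (j <= s a')%N, ((s^-1)%g b < i)%N & (i <= (s^-1)%g b')%N].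
Proof.
move=> As [/andP[i0 lt_i] /andP[j0 lt_j] [cu cl] [cd cr]].
have lt_i' : (i.-1 < n)%N by lia.
have lt_j' : (j.-1 < n)%N by lia.
have := perm_corner_row (Ordinal lt_i') As (ltnW lt_j).
have := perm_corner_row (Ordinal lt_i) As (ltnW lt_j).
have := perm_corner_col (Ordinal lt_j') As (ltnW lt_i).
have := perm_corner_col (Ordinal lt_j) As (ltnW lt_i).
rewrite /= !prednK // cu cl cd cr => r1 r2 r3 r4.
exists (Ordinal lt_i'), (Ordinal lt_i), (Ordinal lt_j'), (Ordinal lt_j).
by split; split; rewrite /= ?prednK //; lia.
Qed.

Lemma covexillary_noncrossing A (s : 'S_n) : asm_val A = perm_mx s ->
  covexillary s -> ~ crossing_ascents n (corner_sum A).
Proof.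
move=> As cov [i [j [k [l [ij kl lt_ik lt_lj]]]]]; apply: cov.
have [_ [b [a' [_ [[_ ib ja _] [_ sb sa _]]]]]] := corner_ascent_perm As ij.
have [c [_ [_ [d' [[kc _ _ ld] [sc _ _ sd]]]]]] := corner_ascent_perm As kl.
(* With rows and columns counted from 0, the pattern has positions [s^-1 (j-1) < i < k-1 < s^-1 l]
   and values [j-1], at least [j], less than [l], and [l]. *)
exists ((s^-1)%g a'), b, c, ((s^-1)%g d'); rewrite !permKV.
have bc : (b : nat) <> c by move=> /val_inj bc; move: sb sc; rewrite bc; lia.
have da : (a' : nat) <> d' by move=> /val_inj ad; move: sd sa; rewrite ad; lia.
by split; split; lia.
Qed.

Lemma neg_entry_crossing A (p q : 'I_n) : A p q = -1 ->
  crossing_ascents n (corner_sum A).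
Proof.
move=> Apq; have cP := asm_corner A; have [c1 c2 c3 c4] := cP.
have := corner_sumE A p q; rewrite Apq.
have lt_p := ltn_ord p; have lt_q := ltn_ord q.
have := c3 p q lt_p (ltnW lt_q); have := c3 p q.+1 lt_p lt_q.
have := c4 p q (ltnW lt_p) lt_q; have := c4 p.+1 q lt_p lt_q => ? ? ? ? ?.
(* A -1 entry forces [c] to equal [c p q + 1] at the three other corners of its cell, so the NE
   corner starts one walk and the SW corner the other. *)
have [||||i [j [ij le_i le_j]]] := corner_ascent_NE (i := p) (j := q.+1) cP; [by rewrite /=; lia..|].
have [||||k [l [kl le_k le_l]]] := corner_ascent_SW (i := p.+1) (j := q) cP; [by rewrite /=; lia..|].
by exists i, j, k, l; split=> //; lia.
Qed.

Lemma asm_nonneg_perm A : (forall p q, 0 <= A p q) ->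
  exists s : 'S_n, asm_val A = perm_mx s.
Proof.
move=> A0; have /andP[/forallP rA /forallP dA] := valP A.
have rE i : \sum_j A i j = 1.
  by have /asm_rowP[<- _] := rA i; apply: eq_bigr => j _; rewrite mxE.
have dE j : \sum_i A i j = 1.
  by have /asm_rowP[<- _] := dA j; apply: eq_bigr => i _; rewrite !mxE.
have uniq (f : 'I_n -> int) : (forall i, 0 <= f i) -> \sum_i f i = 1 ->
    exists2 i, f i = 1 & forall k, k != i -> f k = 0.
  move=> f0 f1; have [/existsP[i fi]|/existsPn no] := boolP [exists i, f i != 0].
    have := f1; rewrite (bigD1 i) //=; set S := \sum_(k | _) _ => e.
    have S0 : 0 <= S by apply: sumr_ge0.
    have /eqP : S = 0 by have := f0 i; move/eqP: fi; lia.
    rewrite psumr_eq0 // => z; exists i; first by have := f0 i; move/eqP: fi; lia.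
    move=> k ki; move/allP: z => /(_ k); rewrite mem_index_enum ki => /(_ isT).
    by move/eqP.
  by move: f1; rewrite big1 // => i _; apply/eqP; rewrite -[_ == _]negbK no.
have [f fP] : exists f : {ffun 'I_n -> 'I_n}, forall i, A i (f i) = 1.
  exists [ffun i => odflt i [pick j | A i j == 1]] => i; rewrite ffunE.
  case: pickP => [j /eqP //|no].
  by have [j Aij] := uniq (A i) (A0 i) (rE i); have := no j; rewrite Aij eqxx.
have f_inj : injective f.
  move=> i k fik; have [a _ z] := uniq (A^~ (f i)) (A0^~ (f i)) (dE (f i)).
  have only m : f m = f i -> m = a.
    by move=> e; apply/eqP/negP=> /negP /z; rewrite -e fP.
  by rewrite (only i erefl) (only k (esym fik)).
exists (perm f_inj); apply/matrixP=> i j; rewrite !mxE permE.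
have [a Aia z] := uniq (A i) (A0 i) (rE i).
have fa : f i = a by apply/eqP/negP=> /negP /z; rewrite fP.
rewrite fa; case: eqP => [<- //|/eqP ne]; by rewrite z // eq_sym.
Qed.

Lemma noncrossing_covexillary A : ~ crossing_ascents n (corner_sum A) ->
  exists s : 'S_n, asm_val A = perm_mx s /\ covexillary s.
Proof.
move=> ncr; have [p q|s As] := @asm_nonneg_perm A.
  have /andP[/forallP /(_ p) /and3P[/forallP /(_ q) + _ _] _] := valP A.
  rewrite mxE !inE => /or3P[]/eqP Apq; rewrite ?Apq //.
  by case: ncr; apply: neg_entry_crossing Apq.
exists s; split=> // -[a [b [c [d [[ab bc cd] [scd sda sab]]]]]]; apply: ncr.
have cP := asm_corner A.
have := ltn_ord b; have := ltn_ord c; have := ltn_ord (s a); have := ltn_ord (s d).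
move=> ? ? ? ?.
have rb := perm_corner_row b As (ltn_ord (s a)).
have ra := perm_corner_col (s a) As (ltnW (ltn_ord b)).
have rc := perm_corner_row c As (ltnW (ltn_ord (s d))).
have rd := perm_corner_col (s d) As (ltn_ord c).
rewrite permK in ra; rewrite permK in rd.
(* The letters 3 and 4 give the start of the NE walk, the letters 1 and 2 that of the SW walk. *)
have [||||i [j [ij le_i le_j]]] := corner_ascent_NE (i := b) (j := (s a).+1) cP.
- lia.
- lia.
- by rewrite rb; lia.
- by rewrite /=; lia.
have [||||k [l [kl le_k le_l]]] := corner_ascent_SW (i := c.+1) (j := s d) cP.
- lia.
- lia.
- by rewrite rd; lia.
- by rewrite /=; lia.
by exists i, j, k, l; split=> //; lia.
Qed.

End Asm.

(** * Join irreducible elements *)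

(* [jasm x] is the least ASM with [c (trow x) (tcol x) <= tx1 x]. *)
Definition trow n (x : tetra n) : nat := (tx1 x + tx2 x).+1.
Definition tcol n (x : tetra n) : nat := (tx1 x + tx3 x).+1.

Lemma tetra_ex n a b c d : (a + b + c + d + 2 = n)%N ->
  exists x : tetra n, [/\ tx1 x = a, tx2 x = b, tx3 x = c & tx4 x = d].
Proof. by move/eqP=> e; exists (@Tetra n (a, b, c, d) e). Qed.

Lemma triang_ex n a b c : (a + b + c + 2 = n)%N ->
  exists y : triang n, [/\ dy1 y = a, dy2 y = b & dy3 y = c].
Proof. by move/eqP=> e; exists (@Triang n (a, b, c) e). Qed.

Section JoinIrreducibles.
Variable n : nat.
Implicit Types (A B : asm n) (x y : tetra n).

Lemma jasm_corner x i j : (i <= n)%N -> (j <= n)%N ->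
  corner_sum (jasm x) i j =
    (minn (minn i j) (tx1 x + (i - trow x) + (j - tcol x)))%:Z.
Proof.
have xP := tetraP x; move=> + le_j; elim: i => [|i IH] lt_in.
  by rewrite corner_sum0l /trow /tcol; lia.
rewrite (corner_sum_rowS _ (Ordinal lt_in)) (IH (ltnW lt_in)) /=.
set k := jfun (tx1 x) (tx2 x) (tx3 x) i.
have lt_k : (k < n)%N by rewrite /k /jfun; do !case: ifP; lia.
have -> : \sum_(b < n | (b < j)%N) jmx x (Ordinal lt_in) b = (k < j)%N%:R.
  under eq_bigr do rewrite jmxE /=.
  case: ltnP => [lt|le].
    rewrite (bigD1 (Ordinal lt_k)) //= eqxx big1 // => b /andP[_].
    by rewrite -val_eqE /= => /negPf ->.
  by rewrite big1 // => b lt; rewrite (_ : (_ == _) = false) //; lia.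
by rewrite /k /jfun /trow /tcol; do !case: ifP; lia.
Qed.

(** By [jasm_corner], the corner sums of [jasm x] are the largest that the Lipschitz and border
    bounds allow once the value at one point is at most [tx1 x]; testing that point therefore
    suffices. *)
Lemma in_J A x : (x \in J A) = (corner_sum A (trow x) (tcol x) <= (tx1 x)%:Z).
Proof.
rewrite inE asm_leE /asm_le; have xP := tetraP x; have cP := asm_corner A.
have le_r : (trow x <= n)%N by rewrite /trow; lia.
have le_c : (tcol x <= n)%N by rewrite /tcol; lia.
apply/hfm_leP/idP=> [le|le i j le_i le_j].
  by apply: le_trans (le _ _ le_r le_c) _; rewrite jasm_corner //; lia.
rewrite jasm_corner //; have [_ b1 b2 _] := corner_bounds cP le_i le_j.
by have := corner_upper cP le_r le_c le_i le_j; lia.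
Qed.

Lemma jasm_le x y : (jasm x <= jasm y)%O = (x <= y)%O.
Proof.
have xP := tetraP x; have yP := tetraP y.
have := in_J (jasm y) x; rewrite inE => ->; rewrite tetra_leE /tetra_le.
by rewrite jasm_corner /trow /tcol; lia.
Qed.

Lemma J_le A B : (J A \subset J B) = (A <= B)%O.
Proof.
apply/subsetP/idP=> [sAB|leAB x]; last by rewrite !inE => /le_trans; apply.
apply/negP=> /negP; rewrite asm_leE => /hfm_leP nle; apply: nle => i j le_i le_j.
rewrite leNgt; apply/negP=> lt.
have [a0 _ _ a1] := corner_bounds (asm_corner A) le_i le_j.
have [_ b1 b2 _] := corner_bounds (asm_corner B) le_i le_j.
have [c cE] : exists c : nat, corner_sum A i j = c.
  by exists `|corner_sum A i j|%N; lia.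
(* This [x] sits at [(i, j)] with threshold [c], so it lies in J(A) but not in J(B); the bounds on
   both corner sums make its coordinates natural numbers. *)
have [|x [x1 x2 x3 x4]] := @tetra_ex n c (i - c.+1) (j - c.+1) (n + c - i - j).
  by lia.
have e : trow x = i /\ tcol x = j by rewrite /trow /tcol x1 x2 x3; lia.
by have := sAB x; rewrite !in_J e.1 e.2 x1; lia.
Qed.

Lemma J_join A B : J (A `|` B)%O = J A :|: J B.
Proof.
apply/setP=> x; rewrite in_setU !in_J corner_sum_join.
- by rewrite ge_min.
- by have := tetraP x; rewrite /trow; lia.
- by have := tetraP x; rewrite /tcol; lia.
Qed.

Lemma J_meet A B : J (A `&` B)%O = J A :&: J B.
Proof. by apply/setP=> x; rewrite !inE lexI. Qed.

Fact min_corner_spec : corner_spec n (fun i j => (minn i j)%:Z).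
Proof. by split=> *; try split; lia. Qed.

Definition asm_bot : asm n := Asm (mx_of_corner_asm min_corner_spec).

Lemma J_bot : J asm_bot = set0.
Proof.
apply/setP=> x; rewrite in_set0 in_J; have xP := tetraP x.
by rewrite (mx_of_cornerK min_corner_spec) /trow /tcol; lia.
Qed.

Definition asm_sup (s : seq (tetra n)) : asm n :=
  foldr (fun x B => jasm x `|` B)%O asm_bot s.

Lemma in_J_sup s x : (x \in J (asm_sup s)) = has (fun y => x <= y)%O s.
Proof.
elim: s => [|y s IH] /=; first by rewrite J_bot in_set0.
by rewrite J_join in_setU IH inE jasm_le.
Qed.

Lemma mset_corner_ascent A x : x \in mset A ->
  corner_ascent n (corner_sum A) (trow x) (tcol x) /\
  corner_sum A (trow x) (tcol x) = (tx1 x).+1.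
Proof.
rewrite inE => /andP[]; rewrite inE in_J -ltNge => xJ /forallP xmin.
have xP := tetraP x; have cP := asm_corner A.
set a := tx1 x in xJ xP *; set b := tx2 x in xP *; set c := tx3 x in xP *.
set d := tx4 x in xP *.
have low a' b' c' d' : (a' + b' + c' + d' + 2 = n)%N ->
    [&& a <= a', b' <= b, c' <= c & d <= d']%N -> (b' + c' < b + c)%N ->
    corner_sum A (a' + b').+1 (a' + c').+1 <= a'%:Z.
  move=> e le lt; have [y [y1 y2 y3 y4]] := tetra_ex e.
  have := xmin y; rewrite in_setC in_J /trow /tcol y1 y2 y3.
  rewrite lt_neqAle tetra_leE /tetra_le y1 y2 y3 y4 le andbT negbK.
  case: leP => //= _ /eqP yx.
  by move: lt; rewrite -y2 -y3 yx ltnn.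
(* The elements just below [x] with smaller [tx2] sit at the north and east neighbours of its point,
   and [low] puts them in J(A). If [tx2 x = 0] there are none, and the row index itself bounds [c].
   [col_le] treats [tx3] likewise. *)
have row_le : corner_sum A (trow x).-1 (tcol x) <= a%:Z /\
              corner_sum A (trow x) (tcol x).+1 <= a.+1%:Z.
  rewrite /trow /tcol -/a -/b -/c /=; case: b xP low => [|b'] xP low.
    have [||_ le1 _ _] := @corner_bounds n _ (a + 0) (a + c).+1 cP; [lia..|].
    have [||_ le2 _ _] := @corner_bounds n _ (a + 0).+1 (a + c).+2 cP; [lia..|].
    by split; lia.
  split; first by rewrite addnS -addSn; apply: (low a b' c d.+1); lia.
  by rewrite addnS -!addSn; apply: (low a.+1 b' c d); lia.
have col_le : corner_sum A (trow x) (tcol x).-1 <= a%:Z /\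
              corner_sum A (trow x).+1 (tcol x) <= a.+1%:Z.
  rewrite /trow /tcol -/a -/b -/c /=; case: c xP low => [|c'] xP low.
    have [||_ _ le1 _] := @corner_bounds n _ (a + b).+1 (a + 0) cP; [lia..|].
    have [||_ _ le2 _] := @corner_bounds n _ (a + b).+2 (a + 0).+1 cP; [lia..|].
    by split; lia.
  split; first by rewrite addnS -addSn; apply: (low a b c' d.+1); lia.
  by rewrite addnS -!addSn; apply: (low a.+1 b c' d); lia.
have [_ _ c3 c4] := cP; rewrite /trow /tcol -/a -/b -/c /= in xJ row_le col_le *.
have := c3 (a + b)%N (a + c).+1; have := c3 (a + b).+1 (a + c).+1.
have := c4 (a + b).+1 (a + c)%N; have := c4 (a + b).+1 (a + c).+1.
by move=> ? ? ? ?; split; first split; rewrite /=; lia.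
Qed.

Lemma corner_ascent_mset A i j : corner_ascent n (corner_sum A) i j ->
  exists x, [/\ x \in mset A, trow x = i & tcol x = j].
Proof.
move=> [i_in j_in [cu cl] [cd cr]]; have cP := asm_corner A.
have [||a0 a1 _ _] := @corner_bounds n _ i.-1 j cP; [lia..|].
have [||_ _ a2 _] := @corner_bounds n _ i j.-1 cP; [lia..|].
have [||_ _ _ a3] := @corner_bounds n _ i.+1 j cP; [lia..|].
have [c cE] : exists c : nat, corner_sum A i j = c.+1.
  by exists `|corner_sum A i j - 1|%N; lia.
have [|x [x1 x2 x3 x4]] := @tetra_ex n c (i - c.+1) (j - c.+1) (n + c - i - j).
  lia.
have [ri ci] : trow x = i /\ tcol x = j by rewrite /trow /tcol x1 x2 x3; lia.
exists x; split=> //; rewrite inE in_setC in_J ri ci x1 -ltNge cE.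
apply/andP; split; first by lia.
apply/forallP=> y; rewrite in_setC in_J; apply/implyP=> yJ.
apply/negP; rewrite lt_neqAle tetra_leE /tetra_le => /andP[yx le].
have yP := tetraP y; have xP := tetraP x.
have lt : (tx2 y < tx2 x)%N || (tx3 y < tx3 x)%N.
  apply: contraR yx => ge; apply/eqP/tetra_inj; lia.
apply/negP: yJ; rewrite negbK.
have U k l := @corner_upper n _ k l (trow y) (tcol y) cP.
have le_ty : (trow y <= n)%N /\ (tcol y <= n)%N by rewrite /trow /tcol; lia.
(* In each case one neighbour of [(i, j)], where [c] is known from the ascent, bounds [c] at the
   point of [y] by [tx1 y]. *)
case/orP: lt => lt.
  have [lt_r|le_r] := ltnP (trow y) i.
    have := U i.-1 j; rewrite cu cE; move: lt_r le_ty; rewrite /trow /tcol; lia.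
  have := U i j.+1; rewrite cr cE; move: le_r le_ty; rewrite /trow /tcol; lia.
have [lt_c|le_c] := ltnP (tcol y) j.
  have := U i j.-1; rewrite cl cE; move: lt_c le_ty; rewrite /trow /tcol; lia.
have := U i.+1 j; rewrite cd cE; move: le_c le_ty; rewrite /trow /tcol; lia.
Qed.

End JoinIrreducibles.

(** * Depth antichains and depth triangles *)

Section DepthTriangles.
Variable n : nat.
Implicit Types (A : asm n) (x : tetra n) (y z : triang n) (delta : triang n -> int).

(** Noncrossing points are ordered from NW to SE. The step into the SE ascent raises [c], so
    monotonicity makes [tx1] strictly larger there; the step out of the NW ascent leaves [c]
    unchanged, so the Lipschitz bound makes [tx4] strictly smaller. *)
Lemma noncrossing_mset A x x' : ~ crossing_ascents n (corner_sum A) ->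
    x \in mset A -> x' \in mset A -> x != x' ->
  [&& tx1 x < tx1 x', tx4 x' < tx4 x, trow x <= trow x' & tcol x <= tcol x']%N ||
  [&& tx1 x' < tx1 x, tx4 x < tx4 x', trow x' <= trow x & tcol x' <= tcol x]%N.
Proof.
move=> ncr; suff H u v : u \in mset A -> v \in mset A -> u != v ->
    (trow u <= trow v)%N -> (tcol u <= tcol v)%N ->
    (tx1 u < tx1 v)%N && (tx4 v < tx4 u)%N.
  move=> mx mx' ne.
  have [ax cx] := mset_corner_ascent mx; have [ax' cx'] := mset_corner_ascent mx'.
  have nlt i j k l : corner_ascent n (corner_sum A) i j ->
      corner_ascent n (corner_sum A) k l -> ~~ ((i < k)%N && (l < j)%N).
    by move=> ij kl; apply/negP=> /andP[? ?]; apply: ncr; exists i, j, k, l.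
  have := nlt _ _ _ _ ax ax'; have := nlt _ _ _ _ ax' ax.
  have := H _ _ mx mx' ne; have := H _ _ mx' mx; rewrite eq_sym => /(_ ne).
  lia.
move=> mu mv ne le_r le_c.
have cP := asm_corner A; have uP := tetraP u; have vP := tetraP v.
have [[ri ci [u1 u2] [u3 u4]] cu] := mset_corner_ascent mu.
have [[rj cj [v1 v2] [v3 v4]] cv] := mset_corner_ascent mv.
have lt_rc : (trow u < trow v)%N || (tcol u < tcol v)%N.
  apply: contraR ne => ge; have [rE cE] : trow u = trow v /\ tcol u = tcol v by lia.
  have : (tx1 u).+1%:Z = (tx1 v).+1%:Z by rewrite -cu -cv rE cE.
  by move: rE cE; rewrite /trow /tcol => *; apply/eqP/tetra_inj; lia.
have U i j k l := @corner_upper n _ i j k l cP.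
have [dr|er] := ltnP (trow u) (trow v).
  have := U (trow v).-1 (tcol v) (trow u) (tcol u).
  have := U (trow u).+1 (tcol u) (trow v) (tcol v).
  by move: cu cv; rewrite v1 u3 => -> ->; move: le_r le_c dr ri rj ci cj;
    rewrite /trow /tcol; lia.
have dc : (tcol u < tcol v)%N by lia.
have := U (trow v) (tcol v).-1 (trow u) (tcol u).
have := U (trow u) (tcol u).+1 (trow v) (tcol v).
by move: cu cv; rewrite v2 u4 => -> ->; move: le_r le_c dc ri rj ci cj;
  rewrite /trow /tcol; lia.
Qed.

Lemma noncrossing_well_defined A :
  ~ crossing_ascents n (corner_sum A) -> eps_well_defined A.
Proof.
move=> ncr x x' mx mx' pE; apply/eqP/negP=> /negP ne.
have e1 : tx1 x = tx1 x' := congr1 (@dy1 n) pE.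
by have := noncrossing_mset ncr mx mx' ne; rewrite e1 ltnn.
Qed.

Lemma eps_mapE A x : eps_well_defined A -> x \in mset A ->
  eps_map A (proj x) = (tx3 x)%:Z - (tx2 x)%:Z.
Proof.
move=> inj mx; rewrite /eps_map; case: pickP => [x' /andP[mx' /eqP]|/(_ x)].
  by move/(inj _ _ mx' mx) ->.
by rewrite mx eqxx.
Qed.

(** Here [tx3 - tx2] is [tcol - trow]. Since [trow] and [tcol] vary in the same direction, its
    variation is at most the sum of theirs, which is the variation of [tx1] minus that of [tx4];
    these two have opposite signs. *)
Lemma noncrossing_depth_antichain A : ~ crossing_ascents n (corner_sum A) ->
  depth_antichain (mbar A) (eps_map A).
Proof.
move=> ncr; have wd := noncrossing_well_defined ncr.
have ncrm x x' mx mx' := @noncrossing_mset A x x' ncr mx mx'.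
split=> [_ _ /imsetP[x mx ->] /imsetP[x' mx' ->] le|_ /imsetP[x mx ->]
        |_ /imsetP[x mx ->]|_ _ /imsetP[x mx ->] /imsetP[x' mx' ->]].
- have [-> //|ne] := eqVneq x x'; have := ncrm _ _ mx mx' ne; move: le.
  rewrite triang_leE /triang_le /dy1 /dy2 /dy3 /=.
  by have := tetraP x; have := tetraP x'; lia.
- by rewrite eps_mapE // /dy2 /=; lia.
- by rewrite eps_mapE // /dy2 /=; lia.
- rewrite !eps_mapE // /dy1 /dy3 /=.
  have [->|ne] := eqVneq x x'; first by rewrite !subrr.
  have := ncrm _ _ mx mx' ne; rewrite /trow /tcol.
  by have := tetraP x; have := tetraP x'; rewrite -/(tx4 x) -/(tx4 x') -/(tx1 x) -/(tx1 x'); lia.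
Qed.

Lemma bigmax_attained (I : finType) (D : {set I}) (v0 : int) (F : I -> int) :
  let m := \big[Num.max/v0]_(i in D) F i in
  [/\ v0 <= m, {in D, forall i, F i <= m} & m = v0 \/ exists2 i, i \in D & m = F i].
Proof.
split=> [|i iD|].
- exact: bigmax_ge_id.
- exact: le_bigmax_cond.
elim/big_rec: _ => [|i m iD IH]; first by left.
case: (leP (F i) m) => _; first exact: IH.
by right; exists i.
Qed.

(* McShane extension: the largest forced value, the boundary condition         *)
(* contributing the term [- dy2 y].                                           *)
Lemma depth_antichain_extends (D : {set triang n}) (eps : triang n -> int) :
  depth_antichain D eps ->
  exists delta, depth_triangle delta /\ {in D, delta =1 eps}.
Proof.
move=> [_ bnd par lip].
pose F y z := eps z - (`|(dy1 y)%:Z - (dy1 z)%:Z| + `|(dy3 y)%:Z - (dy3 z)%:Z|).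
pose d y := \big[Num.max/- (dy2 y)%:Z]_(z in D) F y z.
have dP y : [/\ - (dy2 y)%:Z <= d y, {in D, forall z, F y z <= d y}
    & d y = - (dy2 y)%:Z \/ exists2 z, z \in D & d y = F y z].
  exact: bigmax_attained.
have dpar y : (d y %% 2)%Z = ((dy2 y)%:Z %% 2)%Z.
  have yP := triangP y; have [_ _ [->|[z zD ->]]] := dP y; first lia.
  by have := par z zD; have := triangP z; rewrite /F; lia.
have step y z : `|(dy1 y)%:Z - (dy1 z)%:Z| + `|(dy3 y)%:Z - (dy3 z)%:Z| = 1 ->
    d y <= d z + 1.
  have yP := triangP y; have zP := triangP z.
  move=> yz; have [z1 z2 _] := dP z; have [_ _ [->|[w wD ->]]] := dP y; first lia.
  by have := z2 w wD; rewrite /F; lia.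
(* The values [d y] and [d z] have opposite parities, so a difference of at most 1 is exactly 1. *)
have near y z : (dy2 z).+1 = dy2 y ->
    `|(dy1 y)%:Z - (dy1 z)%:Z| + `|(dy3 y)%:Z - (dy3 z)%:Z| = 1 ->
    `|d y - d z| = 1.
  move=> y2 yz; have := step y z yz; have := step z y.
  have := dpar y; have := dpar z; lia.
exists d; split=> [|y yD].
  split=> [y y0|y z ? ? ?|y z ? ? ?]; [|by apply: near; lia..].
  have yP := triangP y; have [d1 d2 [|[z zD]]] := dP y; rewrite y0 in d1; first lia.
  by have := bnd z zD; have := triangP z; rewrite /F; lia.
have yP := triangP y; have [_ /(_ y yD) + [|[z zD]]] := dP y.
  by have := bnd y yD; rewrite /F; lia.
by have := lip y z yD zD; rewrite /F; lia.
Qed.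

Definition unit_steps delta :=
  (forall y z, dy1 z = dy1 y -> (dy2 z).+1 = dy2 y -> dy3 z = (dy3 y).+1 ->
     `|delta y - delta z| = 1) /\
  (forall y z, dy1 z = (dy1 y).+1 -> (dy2 z).+1 = dy2 y -> dy3 z = dy3 y ->
     `|delta y - delta z| = 1).

(* Two points are joined by a shortest path through points above them, along   *)
(* which the larger of the two coordinates decreases.                         *)
Lemma unit_steps_lipschitz delta : unit_steps delta -> forall y z,
  `|delta y - delta z| <= `|(dy1 y)%:Z - (dy1 z)%:Z| + `|(dy3 y)%:Z - (dy3 z)%:Z|.
Proof.
move=> [s3 s1].
suff H m y z : (`|(dy1 y)%:Z - (dy1 z)%:Z| + `|(dy3 y)%:Z - (dy3 z)%:Z| <= m%:Z) ->
    `|delta y - delta z| <= `|(dy1 y)%:Z - (dy1 z)%:Z| + `|(dy3 y)%:Z - (dy3 z)%:Z|.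
  move=> y z; apply: (H (`|(dy1 y)%:Z - (dy1 z)%:Z|%N + `|(dy3 y)%:Z - (dy3 z)%:Z|%N)%N).
  by lia.
elim: m y z => [|m IH] y z le.
  have yP := triangP y; have zP := triangP z.
  have -> : y = z by apply: triang_inj; lia.
  by rewrite subrr; lia.
have low (u v : triang n) :
    `|(dy1 u)%:Z - (dy1 v)%:Z| + `|(dy3 u)%:Z - (dy3 v)%:Z| <= m.+1%:Z ->
    (dy1 v < dy1 u)%N || (dy3 v < dy3 u)%N ->
    `|delta u - delta v| <= `|(dy1 u)%:Z - (dy1 v)%:Z| + `|(dy3 u)%:Z - (dy3 v)%:Z|.
  move=> {}le lt; have uP := triangP u.
  have [lt1|ge1] := ltnP (dy1 v) (dy1 u).
    have [|w [w1 w2 w3]] := @triang_ex n (dy1 u).-1 (dy2 u).+1 (dy3 u); first lia.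
    by have := s1 w u; have := IH w v; lia.
  have [|w [w1 w2 w3]] := @triang_ex n (dy1 u) (dy2 u).+1 (dy3 u).-1; first lia.
  by have := s3 w u; have := IH w v; lia.
have := low y z le; have := low z y.
have [yz|] := boolP [&& (dy1 z <= dy1 y), (dy3 z <= dy3 y),
                       (dy1 y <= dy1 z) & (dy3 y <= dy3 z)]%N; last lia.
have yP := triangP y; have zP := triangP z.
have -> : y = z by apply: triang_inj; lia.
by rewrite subrr; lia.
Qed.

(** The wall sends [y] to the element with outer coordinates [dy1 y], [dy3 y] and
    [tx3 - tx2 = delta y], which exists by size and parity of [delta]. For [y <= z] the increase of
    [dy2] is the distance of the outer coordinates, so the Lipschitz bound makes [tx2] and [tx3]
    both increase. *)
Lemma depth_triangle_wall A : eps_well_defined A ->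
    (exists delta, depth_triangle delta /\ {in mbar A, delta =1 eps_map A}) ->
  exists W : {set tetra n}, is_wall W /\ mset A \subset W.
Proof.
move=> wd [delta [[d0 d3 d1] dE]].
have lip := unit_steps_lipschitz (conj d3 d1).
have bnd y : `|delta y| <= (dy2 y)%:Z.
  have yP := triangP y.
  have [|z [z1 z2 z3]] := @triang_ex n (dy1 y + dy2 y) 0 (dy3 y); first lia.
  by have := lip y z; rewrite (d0 z z2); lia.
have par y : (delta y %% 2)%Z = ((dy2 y)%:Z %% 2)%Z.
  move: {-1}(dy2 y) (erefl (dy2 y)) => m; elim: m y => [|m IH] y y2.
    by rewrite d0.
  have yP := triangP y.
  have [|z [z1 z2 z3]] := @triang_ex n (dy1 y).+1 m (dy3 y); first lia.
  by have := IH z z2; have := d1 y z z1; rewrite z2 y2 z3; lia.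
have ex y : exists x : tetra n, [/\ tx1 x = dy1 y, tx4 x = dy3 y
    & (tx3 x)%:Z - (tx2 x)%:Z = delta y].
  have yP := triangP y; have := par y; have := bnd y => b p.
  have [s sE] : exists s : nat, (dy2 y)%:Z - delta y = s.*2%:Z.
    by exists (`|(dy2 y)%:Z - delta y|%N./2); lia.
  have [|x [x1 x2 x3 x4]] := @tetra_ex n (dy1 y) s (dy2 y - s) (dy3 y); first lia.
  by exists x; split=> //; lia.
have [f fP] := fin_all_exists ex.
have f_mono : {mono f : y z / (y <= z)%O}.
  move=> y z; rewrite tetra_leE triang_leE /tetra_le /triang_le.
  have [y1 y4 yd] := fP y; have [z1 z4 zd] := fP z; have := lip y z.
  have := tetraP (f y); have := tetraP (f z); have := triangP y; have := triangP z.
  by rewrite y1 y4 z1 z4 -yd -zd; lia.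
exists [set f y | y in [set: triang n]]; split; first by exists f.
apply/subsetP=> x mx; apply/imsetP; exists (proj x); rewrite ?inE //.
have [f1 f4 fd] := fP (proj x); have := tetraP (f (proj x)); have := tetraP x.
move: fd; rewrite dE ?imset_f // eps_mapE // => fd ? ?.
have {f1} : tx1 (f (proj x)) = tx1 x := f1.
have {f4} : tx4 (f (proj x)) = tx4 x := f4.
by move=> *; apply: tetra_inj; lia.
Qed.

End DepthTriangles.

(** * Walls *)

Lemma unit_walk_affine (p : nat -> int) (m : nat) :
    (forall a, (a < m)%N -> `|p a.+1 - p a| = 1) ->
    (forall a, (a.+1 < m)%N -> p a.+2 != p a) ->
  (forall a, (a <= m)%N -> p a = p 0%N + a%:Z) \/
  (forall a, (a <= m)%N -> p a = p 0%N - a%:Z).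
Proof.
move=> step back.
have dE a : (a < m)%N -> p a.+1 - p a = p 1%N - p 0%N.
  elim: a => // a IH lt; have := IH (ltnW lt); have := step a (ltnW lt).
  by have := step a.+1 lt; have := back a lt; lia.
have [m0|m_gt0] := posnP m.
  by left=> a; rewrite m0 leqn0 => /eqP ->; lia.
have := step 0%N m_gt0; have [p1|p1 s0] := eqVneq (p 1%N) (p 0%N + 1).
  move=> _; left; elim=> [|a IH] lt; first lia.
  by have := IH (ltnW lt); have := dE a lt; lia.
right; elim=> [|a IH] lt; first lia.
by have := IH (ltnW lt); have := dE a lt; lia.
Qed.

Section Walls.
Variables (n : nat) (f : triang n -> tetra n).
Hypothesis f_mono : {mono f : y z / (y <= z)%O}.
Implicit Types y z : triang n.

Lemma wall_inj : injective f.
Proof. by move=> y z e; apply: le_anti; rewrite -!f_mono e lexx. Qed.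

Lemma wall_strict y z : (y <= z)%O -> y != z ->
  (tx2 (f y) + tx3 (f y) < tx2 (f z) + tx3 (f z))%N.
Proof.
rewrite -f_mono tetra_leE /tetra_le -(inj_eq wall_inj) => le.
apply: contraR => ge; have := tetraP (f y); have := tetraP (f z) => ? ?.
by apply/eqP/tetra_inj; lia.
Qed.

(** Both posets are graded with ranks from 0 to n - 2. The rank of the image increases strictly
    along chains, so a chain up to the top bounds it from above and a chain down to a minimal
    element from below. *)
Lemma wall_rank y : (tx2 (f y) + tx3 (f y) = dy2 y)%N.
Proof.
apply/eqP; rewrite eqn_leq; apply/andP; split.
  suff H m : forall z, (dy1 z + dy3 z <= m)%N -> (tx2 (f z) + tx3 (f z) <= dy2 z)%N.
    exact: H (leqnn _).
  elim: m => [|m IH] z le; have zP := triangP z; have := tetraP (f z); first lia.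
  have [z0|z_gt0] := posnP (dy1 z + dy3 z); first lia.
  have [u [uz zu u2]] : exists u, [/\ (z <= u)%O, z != u & dy2 u = (dy2 z).+1].
    have [z1|z1] := posnP (dy1 z).
      have [|u [u1 u2 u3]] := @triang_ex n (dy1 z) (dy2 z).+1 (dy3 z).-1; first lia.
      exists u; rewrite triang_leE /triang_le u1 u2 u3; split=> //; first lia.
      by apply/eqP=> e; rewrite -e in u2; lia.
    have [|u [u1 u2 u3]] := @triang_ex n (dy1 z).-1 (dy2 z).+1 (dy3 z); first lia.
    exists u; rewrite triang_leE /triang_le u1 u2 u3; split=> //; first lia.
    by apply/eqP=> e; rewrite -e in u2; lia.
  by have := wall_strict uz zu; have := IH u; have := triangP u; lia.
suff H m : forall z, dy2 z = m -> (m <= tx2 (f z) + tx3 (f z))%N by exact: H.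
elim: m => // m IH z z2; have zP := triangP z.
have [|u [u1 u2 u3]] := @triang_ex n (dy1 z).+1 m (dy3 z); first lia.
have uz : (u <= z)%O by rewrite triang_leE /triang_le; lia.
have ne : u != z by apply/eqP=> e; rewrite e in u2; lia.
by have := wall_strict uz ne; have := IH u u2; lia.
Qed.

(* On the minimal elements [f] acts as a self-avoiding unit walk, so it is the *)
(* identity or the reversal; since [f y] dominates as many minimal elements as *)
(* [y], its outer coordinates are those of [y], possibly exchanged.            *)
Lemma wall_distance y z :
  `|(dy1 y)%:Z - (dy1 z)%:Z| + `|(dy3 y)%:Z - (dy3 z)%:Z| =
  `|(tx1 (f y))%:Z - (tx1 (f z))%:Z| + `|(tx4 (f y))%:Z - (tx4 (f z))%:Z|.
Proof.
(* The walk followed by the images of the minimal elements [(a, 0, n - 2 - a)]; the default 0 only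
   serves indices outside the triangle. *)
pose p a : int := if insub (a, 0, n - 2 - a)%N is Some w then (tx1 (f w))%:Z else 0.
have pE w : dy2 w = 0%N -> (tx1 (f w))%:Z = p (dy1 w).
  move=> w2; have wP := triangP w; rewrite /p.
  suff -> : (dy1 w, 0, n - 2 - dy1 w)%N = val w by rewrite valK.
  rewrite (_ : n - 2 - dy1 w = dy3 w)%N; last lia.
  by move: w2; rewrite /dy1 /dy2 /dy3; case: (w) => [[[? ?] ?] ?] /= ->.
have yP := triangP y; have zP := triangP z.
have step a : (a < n - 2)%N -> `|p a.+1 - p a| = 1.
  move=> lt; have [|u [u1 u2 u3]] := @triang_ex n a 0 (n - 2 - a); first lia.
  have [|v [v1 v2 v3]] := @triang_ex n a.+1 0 (n - 3 - a); first lia.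
  have [|w [w1 w2 w3]] := @triang_ex n a 1 (n - 3 - a); first lia.
  have uw : (f u <= f w)%O by rewrite f_mono triang_leE /triang_le; lia.
  have vw : (f v <= f w)%O by rewrite f_mono triang_leE /triang_le; lia.
  have ne : f u != f v by rewrite (inj_eq wall_inj); apply/eqP=> e; rewrite e v1 in u1; lia.
  rewrite -v1 -u1 -(pE u u2) -(pE v v2).
  have := wall_rank u; have := wall_rank v; have := wall_rank w.
  move: uw vw; rewrite !tetra_leE /tetra_le.
  have := tetraP (f u); have := tetraP (f v); have := tetraP (f w) => *.
  have [e|] := eqVneq (tx1 (f u)) (tx1 (f v)); last lia.
  by case/eqP: ne; apply: tetra_inj; lia.
have back a : (a.+1 < n - 2)%N -> p a.+2 != p a.
  move=> lt; have [|u [u1 u2 u3]] := @triang_ex n a 0 (n - 2 - a); first lia.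
  have [|v [v1 v2 v3]] := @triang_ex n a.+2 0 (n - 4 - a); first lia.
  have ne : f u != f v by rewrite (inj_eq wall_inj); apply/eqP=> e; rewrite e v1 in u1; lia.
  rewrite -v1 -u1 -(pE u u2) -(pE v v2); apply: contra_neq ne => e.
  have := wall_rank u; have := wall_rank v.
  by have := tetraP (f u); have := tetraP (f v) => *; apply: tetra_inj; lia.
(* The minimal elements below [w] have first coordinates from [dy1 w] to [dy1 w + dy2 w]. Their
   images lie below [f w], which confines [p]; on an affine walk the two extreme ones determine
   [tx1 (f w)]. *)
have corners w :
    [/\ (tx1 (f w))%:Z <= p (dy1 w), (tx1 (f w))%:Z <= p (dy1 w + dy2 w)%N,
        p (dy1 w) <= (tx1 (f w) + dy2 w)%:Z &
        p (dy1 w + dy2 w)%N <= (tx1 (f w) + dy2 w)%:Z].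
  have wP := triangP w; have rw := wall_rank w; have tw := tetraP (f w).
  have low u : dy2 u = 0%N -> (u <= w)%O ->
      (tx1 (f w))%:Z <= p (dy1 u) <= (tx1 (f w) + dy2 w)%:Z.
    move=> u2; rewrite -f_mono tetra_leE /tetra_le -pE // => le.
    by have := wall_rank u; have := tetraP (f u); lia.
  have [|u [u1 u2 u3]] := @triang_ex n (dy1 w) 0 (dy2 w + dy3 w); first lia.
  have [|v [v1 v2 v3]] := @triang_ex n (dy1 w + dy2 w) 0 (dy3 w); first lia.
  have := low u u2; have := low v v2; rewrite !triang_leE /triang_le u1 v1 => lv lu.
  by split; lia.
have [y1 y2 y3 y4] := corners y; have [z1 z2 z3 z4] := corners z.
have := wall_rank y; have := wall_rank z.
have := tetraP (f y); have := tetraP (f z).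
have [le_y le_y'] : (dy1 y <= n - 2)%N /\ (dy1 y + dy2 y <= n - 2)%N by lia.
have [le_z le_z'] : (dy1 z <= n - 2)%N /\ (dy1 z + dy2 z <= n - 2)%N by lia.
case: (unit_walk_affine step back) => H; rewrite (H _ le_y) (H _ le_y') in y1 y2 y3 y4;
  rewrite (H _ le_z) (H _ le_z') in z1 z2 z3 z4.
- move=> tz ty rz ry.
  have ey : (tx1 (f y))%:Z = p 0%N + (dy1 y)%:Z by lia.
  have ez : (tx1 (f z))%:Z = p 0%N + (dy1 z)%:Z by lia.
  lia.
- move=> tz ty rz ry.
  have ey : (tx1 (f y))%:Z = p 0%N - (dy1 y + dy2 y)%:Z by lia.
  have ez : (tx1 (f z))%:Z = p 0%N - (dy1 z + dy2 z)%:Z by lia.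
  lia.
Qed.

Lemma wall_steps : unit_steps (fun y => (tx3 (f y))%:Z - (tx2 (f y))%:Z).
Proof.
have step y z : (z <= y)%O -> (dy2 z).+1 = dy2 y ->
    `|((tx3 (f y))%:Z - (tx2 (f y))%:Z) - ((tx3 (f z))%:Z - (tx2 (f z))%:Z)| = 1.
  rewrite -f_mono tetra_leE /tetra_le -!wall_rank.
  by have := tetraP (f y); have := tetraP (f z); lia.
split=> y z z1 z2 z3; apply: step => //; rewrite triang_leE /triang_le; lia.
Qed.

End Walls.

(** For crossing ascents, [tx3 - tx2] varies by [(k - i) + (j - l)]. Comparing both with [c k j]
    bounds the change of [c] strictly by [k - i] on one side and [j - l] on the other, so the outer
    coordinates vary by strictly less. *)
Lemma wall_noncrossing n (A : asm n) :
    (exists W : {set tetra n}, is_wall W /\ mset A \subset W) ->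
  ~ crossing_ascents n (corner_sum A).
Proof.
move=> [_ [[f f_mono ->] /subsetP mW]] [i [j [k [l [ij kl lt_ik lt_lj]]]]].
have [x [mx xi xj]] := corner_ascent_mset ij.
have [x' [mx' xk xl]] := corner_ascent_mset kl.
have /imsetP[y _ xE] := mW x mx; have /imsetP[z _ xE'] := mW x' mx'.
have := unit_steps_lipschitz (wall_steps f_mono) y z.
rewrite (wall_distance f_mono) -xE -xE'.
have cP := asm_corner A; have xP := tetraP x; have xP' := tetraP x'.
have [_ cx] := mset_corner_ascent mx; have [_ cx'] := mset_corner_ascent mx'.
have [i_in j_in [_ cl] [cd _]] := ij; have [k_in l_in [_ cl'] [cd' cr']] := kl.
have := @corner_upper n _ i.+1 j k j cP; have := @corner_upper n _ k j k l cP.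
have := @corner_upper n _ k l.+1 k j cP; have := @corner_upper n _ k j i j cP.
rewrite xi xj xk xl in cx cx'; rewrite cd cr' cx cx'.
move: xi xj xk xl i_in j_in k_in l_in lt_ik lt_lj; rewrite /trow /tcol.
move: (corner_sum A k j) => ckj.
lia.
Qed.

(** * Dyck paths as lower sets *)

Section DyckIdeals.
Variable n : nat.
Implicit Types (P Q : dyck n) (y z : triang n) (S : {set triang n}).

Lemma heightS P k : (k < n.*2)%N -> `|height P k.+1 - height P k| = 1.
Proof.
move=> lt; rewrite /height (take_nth false) ?size_tuple // big_rcons /=.
by rewrite addrC addrK; case: nth.
Qed.

Lemma height_ge0 P k : (k <= n.*2)%N -> 0 <= height P k.
Proof.
by rewrite -ltnS => lt; have /andP[/forallP /(_ (Ordinal lt))] := valP P.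
Qed.

Lemma height0 P : height P 0 = 0.
Proof. by rewrite /height take0 big_nil. Qed.

Lemma height_end P : height P n.*2 = 0.
Proof. by have /andP[_ /eqP] := valP P. Qed.

Lemma height_parity P k : (k <= n.*2)%N -> (height P k %% 2)%Z = (k%:Z %% 2)%Z.
Proof.
elim: k => [|k IH] lt; first by rewrite height0.
by have := IH (ltnW lt); have := heightS P lt; lia.
Qed.

Lemma height_lipschitz P k l : (k <= n.*2)%N -> (l <= n.*2)%N ->
  `|height P k - height P l| <= `|k%:Z - l%:Z|.
Proof.
wlog le_kl : k l / (k <= l)%N => [H le_k le_l|].
  by have [/H|/ltnW /H] := leqP k l; [apply|rewrite distrC [leRHS]distrC; apply].
move=> _; rewrite -(subnK le_kl); elim: (l - k)%N => [|d IH] le; first by rewrite add0n; lia.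
have lt : (d + k < n.*2)%N by [].
by have := IH (ltnW lt); have := heightS P lt; rewrite addSn; lia.
Qed.

(* [in_dyck P y]: the path [P] passes weakly above the peak of [y]. *)
Definition apex y : nat := ((dy1 y).*2 + dy2 y + 2)%N.
Definition in_dyck P y : bool := (dy2 y + 2)%:Z <= height P (apex y).

Lemma apex_le y : (apex y <= n.*2)%N.
Proof. by have := triangP y; rewrite /apex; lia. Qed.

Lemma in_dyck_le P y z : (y <= z)%O -> in_dyck P z -> in_dyck P y.
Proof.
rewrite triang_leE /triang_le /in_dyck => le Pz.
have := height_lipschitz P (apex_le y) (apex_le z); rewrite /apex in Pz *.
by have := triangP y; have := triangP z; lia.
Qed.

(** A point of [P] at height at least 2 is the peak of the tent of some [y]; a height below 2 is
    forced by parity and nonnegativity. *)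
Lemma dyck_leP P Q : reflect (forall y, in_dyck P y -> in_dyck Q y) (P <= Q)%O.
Proof.
rewrite dyck_leE; apply: (iffP forallP) => [le y|imp [k lt_k] /=].
  by move=> Py; apply: le_trans Py _; have := le (Ordinal (apex_le y : (_ < _.+1)%N)).
have le_k : (k <= n.*2)%N by [].
have := height_parity P le_k; have := height_parity Q le_k.
have := height_ge0 P le_k; have := height_ge0 Q le_k.
have := height_lipschitz P le_k (leq0n _); have := height_lipschitz P le_k (leqnn _).
rewrite height0 height_end => le2 le0 Q0 P0 Qp Pp.
have [a aE] : exists a : nat, height P k = a by exists `|height P k|%N; lia.
have [small|big] := ltnP a 2; first lia.
have [|y [y1 y2 y3]] := @triang_ex n ((k - a)./2) (a - 2) (n - a - (k - a)./2); first lia.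
have apexE : apex y = k by rewrite /apex y1 y2; lia.
by have := imp y; rewrite /in_dyck apexE aE y2; lia.
Qed.

(* Upper envelope of the tents with the given peaks. *)
Definition tents S (k : nat) : int :=
  \big[Num.max/(odd k)%:Z]_(y in S) ((dy2 y + 2)%:Z - `|k%:Z - (apex y)%:Z|).

Lemma tentsP S k : [/\ (odd k)%:Z <= tents S k,
    {in S, forall y, (dy2 y + 2)%:Z - `|k%:Z - (apex y)%:Z| <= tents S k}
  & tents S k = odd k \/
    exists2 y, y \in S & tents S k = (dy2 y + 2)%:Z - `|k%:Z - (apex y)%:Z|].
Proof. exact: bigmax_attained. Qed.

Lemma tentsS S k : `|tents S k.+1 - tents S k| = 1.
Proof.
have par l : (tents S l %% 2)%Z = (l%:Z %% 2)%Z.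
  by have [_ _ [->|[y _ ->]]] := tentsP S l; rewrite /apex; lia.
have := par k; have := par k.+1.
have [o1 t1 a1] := tentsP S k; have [o2 t2 a2] := tentsP S k.+1.
have le1 : tents S k <= tents S k.+1 + 1.
  by case: a1 => [->|[y yS ->]]; [lia | have := t2 y yS; lia].
have le2 : tents S k.+1 <= tents S k + 1.
  by case: a2 => [->|[y yS ->]]; [lia | have := t1 y yS; lia].
lia.
Qed.

Definition tents_word S : n.*2.-tuple bool :=
  [tuple tents S k < tents S k.+1 | k < n.*2].

Lemma height_tents S k : (k <= n.*2)%N -> height (tents_word S) k = tents S k.
Proof.
elim: k => [_|k IH lt].
  rewrite /height take0 big_nil; have [o _ [->|[y _ yE]]] := tentsP S 0 => //.
  by move: o; rewrite yE /apex; lia.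
rewrite /height (take_nth false) ?size_tuple // big_rcons /= -/(height _ _).
rewrite (IH (ltnW lt)).
have -> : nth false (tents_word S) k = tnth (tents_word S) (Ordinal lt).
  by rewrite (tnth_nth false).
by rewrite tnth_mktuple /=; have := tentsS S k; case: ltP; lia.
Qed.

Fact tents_dyck S : is_dyck (tents_word S).
Proof.
apply/andP; split.
  apply/forallP=> k; rewrite height_tents ?leq_ord //.
  by have [o _ _] := tentsP S k; apply: le_trans o; lia.
rewrite height_tents //; have [o t a] := tentsP S n.*2.
case: a o => [->|[y _ ->]]; first by rewrite odd_double.
by rewrite odd_double /apex; have := triangP y; lia.
Qed.

Definition dyck_of S : dyck n := Dyck (tents_dyck S).

(** The base zigzag stays below height 2, so only a tent with peak above that of [y] can reach it:
    the path encodes the lower set generated by [S]. *)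
Lemma in_dyck_of S y : in_dyck (dyck_of S) y = [exists z in S, (y <= z)%O].
Proof.
rewrite /in_dyck height_tents ?apex_le //; have [o t a] := tentsP S (apex y).
have yP := triangP y.
apply/idP/exists_inP=> [le|[z zS]].
  case: a le => [->|[z zS ->]] le; first by move: le; lia.
  exists z => //; rewrite triang_leE /triang_le; have zP := triangP z.
  by move: le; rewrite /apex; lia.
rewrite triang_leE /triang_le => le; have := t z zS; have zP := triangP z.
by move: le; rewrite /apex; lia.
Qed.

End DyckIdeals.

(** * Catalan congruences *)

Lemma quot_leE d (L : latticeType d) (e : equiv_rel L) (x y : L) :
  lattice_congruence e ->
  quot_le (\pi_{eq_quot e} x) (\pi_{eq_quot e} y) = e (x `|` y)%O y.
Proof. by move=> eP; rewrite /quot_le quot_joinE //; apply/eqP/eqmodP. Qed.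

(** * From a wall to a catalan congruence *)

Section WallCongruence.
Variables (n : nat) (f : triang n -> tetra n).
Hypothesis f_mono : {mono f : y z / (y <= z)%O}.
Implicit Types (A B C : asm n) (y z : triang n) (P : dyck n).

Definition wall_dyck B : dyck n := dyck_of [set y | f y \in J B].

Lemma in_wall_dyck B y : in_dyck (wall_dyck B) y = (f y \in J B).
Proof.
rewrite in_dyck_of; apply/exists_inP/idP=> [[z]|fy]; last by exists y; rewrite ?inE in fy *.
by rewrite !inE => fz le; apply: le_trans fz; rewrite jasm_le f_mono.
Qed.

Lemma wall_dyck_le B C :
  reflect (forall y, f y \in J B -> f y \in J C) (wall_dyck B <= wall_dyck C)%O.
Proof.
by apply: (iffP (dyck_leP _ _)) => H y; have := H y; rewrite !in_wall_dyck.
Qed.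

Lemma wall_dyck_eq B C :
  (wall_dyck B == wall_dyck C) = [forall y, (f y \in J B) == (f y \in J C)].
Proof.
apply/eqP/forallP=> [e y|e]; first by rewrite -!in_wall_dyck e.
by apply/le_anti/andP; split; apply/wall_dyck_le=> y; rewrite (eqP (e y)).
Qed.

Definition wall_equiv B C : bool := wall_dyck B == wall_dyck C.

Fact wall_equiv_refl : reflexive wall_equiv.
Proof. by move=> B; apply: eqxx. Qed.

Fact wall_equiv_sym : symmetric wall_equiv.
Proof. by move=> B C; apply: eq_sym. Qed.

Fact wall_equiv_trans : transitive wall_equiv.
Proof. by move=> B A C /eqP AB /eqP BC; rewrite /wall_equiv AB BC. Qed.

Canonical wall_equiv_rel :=
  EquivRel wall_equiv wall_equiv_refl wall_equiv_sym wall_equiv_trans.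

Lemma wall_congruence : lattice_congruence wall_equiv_rel.
Proof.
move=> B B' C C'; rewrite /= /wall_equiv !wall_dyck_eq => /forallP eB /forallP eC.
by split; apply/forallP=> y; rewrite ?J_join ?J_meet !(in_setU, in_setI)
  (eqP (eB y)) (eqP (eC y)).
Qed.

Definition dyck_asm P : asm n :=
  asm_sup [seq f y | y <- enum [set y | in_dyck P y]].

Lemma dyck_asmK P : wall_dyck (dyck_asm P) = P.
Proof.
have in_eq y : (f y \in J (dyck_asm P)) = in_dyck P y.
  rewrite in_J_sup has_map; apply/hasP/idP=> [[z]|Py].
    by rewrite mem_enum inE /= f_mono => Pz le; apply: in_dyck_le Pz.
  by exists y; rewrite ?mem_enum ?inE /=.
by apply/le_anti/andP; split; apply/dyck_leP=> y; rewrite in_wall_dyck in_eq.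
Qed.

Lemma wall_catalan : catalan_congruence wall_equiv_rel.
Proof.
split; first exact: wall_congruence.
have reprE B : wall_dyck (repr (\pi_{eq_quot wall_equiv_rel} B)) = wall_dyck B.
  have /eqmodP /eqP -> // : repr (\pi_{eq_quot wall_equiv_rel} B) = B
    %[mod_eq wall_equiv_rel] by rewrite reprK.
exists (fun X => wall_dyck (repr X)).
  exists (fun P => \pi_{eq_quot wall_equiv_rel} (dyck_asm P)) => [X|P]; last by rewrite reprE dyck_asmK.
  rewrite -[RHS]reprK; apply/eqmodP/eqP; exact: dyck_asmK.
move=> X Y; set B := repr X; set C := repr Y.
rewrite -[X]reprK -[Y]reprK quot_leE ?reprE; last exact: wall_congruence.
rewrite /= /wall_equiv -/B -/C.
rewrite wall_dyck_eq; apply/wall_dyck_le/forallP=> [le y|e y fB].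
  by rewrite J_join in_setU; apply/eqP; have := le y; case: (f y \in J B) => // ->.
by rewrite -(eqP (e y)) J_join in_setU fB.
Qed.

End WallCongruence.

Lemma mset_below n (A : asm n) (x : tetra n) : x \notin J A ->
  exists2 m, m \in mset A & (m <= x)%O.
Proof.
move=> xA; pose D := [pred m | (m \notin J A) && (m <= x)%O].
have Dx : D x by rewrite /D /= xA lexx.
case: (arg_minnP (fun m => tx2 m + tx3 m)%N Dx) => m /andP[mA mx] mmin.
exists m => //; rewrite inE in_setC mA; apply/forallP=> m'.
rewrite in_setC; apply/implyP=> m'A; apply/negP=> lt.
have := mmin m'; rewrite /D /= m'A (le_trans (ltW lt) mx) => /(_ isT).
move: lt; rewrite lt_neqAle tetra_leE /tetra_le => /andP[ne le] ge.
case/eqP: ne; have := tetraP m; have := tetraP m' => *.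
by apply: tetra_inj; lia.
Qed.

(** If [B > A], some element of J(B) outside J(A) dominates an [m] in m(A). That [m] lies on the
    wall and in J(B), so it separates the two classes. *)
Lemma wall_maximal n (A : asm n) :
    (exists W : {set tetra n}, is_wall W /\ mset A \subset W) ->
  exists e : equiv_rel (asm n),
    catalan_congruence e /\ (forall B : asm n, e A B -> ~~ (A < B)%O).
Proof.
move=> [_ [[f f_mono ->] /subsetP mW]].
exists (wall_equiv_rel f); split; first exact: wall_catalan.
move=> B; rewrite /= /wall_equiv wall_dyck_eq // => /forallP e.
rewrite lt_neqAle; apply/negP=> /andP[ne le]; case/negP: ne.
rewrite eq_le le -J_le; apply/subsetP=> x xB; apply/negPn/negP=> xA.
have [m mA mx] := mset_below xA; have /imsetP[y _ mE] := mW m mA.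
have mB : m \in J B by move: xB; rewrite !inE => /(le_trans _); apply; rewrite jasm_le.
by move: mA mB; rewrite inE in_setC => /andP[/negPf mA _]; rewrite mE -(eqP (e y)) -mE mA.
Qed.

(** * From a catalan congruence to a wall *)

Section CongruenceWall.
Variables (n : nat) (e : equiv_rel (asm n)) (f : {eq_quot e} -> dyck n).
Hypotheses (eP : lattice_congruence e) (f_bij : bijective f).
Hypothesis f_le : forall X Y, (f X <= f Y)%O = quot_le X Y.
Implicit Types (A B C : asm n) (P : dyck n) (y z : triang n).

Definition class_dyck A : dyck n := f (\pi_{eq_quot e} A).

Lemma class_dyck_le A B : (class_dyck A <= class_dyck B)%O = e (A `|` B)%O B.
Proof.
by rewrite f_le quot_leE.
Qed.

Lemma class_dyck_homo A B : (A <= B)%O -> (class_dyck A <= class_dyck B)%O.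
Proof. by rewrite class_dyck_le => /join_idPr ->; apply: equiv_refl. Qed.

Lemma class_dyck_surj P : exists A, class_dyck A = P.
Proof.
have [g _ gK] := f_bij; exists (repr (g P)).
by rewrite /class_dyck reprK gK.
Qed.

Lemma class_dyck_inj A B : class_dyck A = class_dyck B -> e A B.
Proof. by move=> /(bij_inj f_bij) /eqmodP. Qed.

Lemma class_dyck_bot y : ~~ in_dyck (class_dyck (asm_bot n)) y.
Proof.
have [A AE] := class_dyck_surj (dyck_of set0).
have le : (class_dyck (asm_bot n) <= class_dyck A)%O.
  by apply: class_dyck_homo; rewrite -J_le J_bot sub0set.
apply/negP=> /(elimT (dyck_leP _ _) le); rewrite AE in_dyck_of => /exists_inP[z].
by rewrite inE.
Qed.

(** Take [C] whose class encodes the union of the two lower sets; it dominates both classes, hence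
    their join by compatibility of [e]. *)
Lemma class_dyck_join A B y : in_dyck (class_dyck (A `|` B)%O) y ->
  in_dyck (class_dyck A) y || in_dyck (class_dyck B) y.
Proof.
pose S := [set z | in_dyck (class_dyck A) z || in_dyck (class_dyck B) z].
have [C CE] := class_dyck_surj (dyck_of S).
have inC z : in_dyck (class_dyck C) z =
    in_dyck (class_dyck A) z || in_dyck (class_dyck B) z.
  rewrite CE in_dyck_of; apply/exists_inP/idP=> [[w]|zS].
    rewrite inE => + le => /orP[] /(in_dyck_le le) -> //; exact: orbT.
  by exists z; rewrite ?inE.
have leA : (class_dyck A <= class_dyck C)%O by apply/dyck_leP=> z; rewrite inC => ->.
have leB : (class_dyck B <= class_dyck C)%O.
  by apply/dyck_leP=> z; rewrite inC orbC => ->.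
suff /dyck_leP /(_ y) : (class_dyck (A `|` B)%O <= class_dyck C)%O by rewrite inC.
move: leA leB; rewrite !class_dyck_le => leA leB.
by have [+ _] := eP leA leB; rewrite joinACA joinxx.
Qed.

Lemma class_dyck_meet A B y : in_dyck (class_dyck A) y ->
  in_dyck (class_dyck B) y -> in_dyck (class_dyck (A `&` B)%O) y.
Proof.
move=> yA yB; have [C CE] := class_dyck_surj (dyck_of [set y]).
have inC z : in_dyck (class_dyck C) z = (z <= y)%O.
  rewrite CE in_dyck_of; apply/exists_inP/idP=> [[w]|le]; first by rewrite inE => /eqP ->.
  by exists y; rewrite ?inE.
have absorb D : in_dyck (class_dyck D) y -> e C (D `&` C)%O.
  move=> yD; have : (class_dyck C <= class_dyck D)%O.
    by apply/dyck_leP=> z; rewrite inC => le; apply: in_dyck_le yD.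
  rewrite class_dyck_le => /eP /(_ (equiv_refl e C)) [_].
  by rewrite meetC joinKI.
have [_ eC] := eP (absorb A yA) (absorb B yB).
have CE' : class_dyck C = class_dyck ((A `&` B) `&` C)%O.
  by congr f; apply/eqmodP; move: eC; rewrite meetxx meetACA meetxx.
have : (class_dyck C <= class_dyck (A `&` B)%O)%O.
  by rewrite CE'; apply/class_dyck_homo/leIl.
by move=> /dyck_leP; apply; rewrite inC.
Qed.

(** [B] lies below the join of the [jasm x] for [x] in J(B), and by [class_dyck_join] one of the
    joinands already accounts for [y]. *)
Lemma class_dyck_prime B y : in_dyck (class_dyck B) y ->
  exists2 x, x \in J B & in_dyck (class_dyck (jasm x)) y.
Proof.
have le : (B <= asm_sup (enum (J B)))%O.
  rewrite -J_le; apply/subsetP=> x xB; rewrite in_J_sup; apply/hasP.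
  by exists x; rewrite ?mem_enum.
move/(elimT (dyck_leP _ _) (class_dyck_homo le)).
have : {subset enum (J B) <= J B} by move=> x; rewrite mem_enum.
elim: (enum (J B)) => [_|x s IH sub] /=; first by rewrite (negPf (class_dyck_bot y)).
case/class_dyck_join/orP=> [yx|]; first by exists x; rewrite ?sub ?mem_head.
by apply: IH => u us; apply: sub; rewrite inE us orbT.
Qed.

(* The least element of the class of the tent below [y] is join irreducible;   *)
(* these join irreducible elements form the wall of the congruence.            *)
Lemma class_dyck_least y :
  exists x, forall B, in_dyck (class_dyck B) y = (x \in J B).
Proof.
have [B BE] := class_dyck_surj (dyck_of [set y]).
have yB : in_dyck (class_dyck B) y.
  by rewrite BE in_dyck_of; apply/exists_inP; exists y; rewrite ?inE.
have [x0 _ x0y] := class_dyck_prime yB.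
pose D := [pred x | in_dyck (class_dyck (jasm x)) y].
case: (@arg_minnP _ x0 D (fun x => tx2 x + tx3 x)%N x0y) => x xy xmin.
exists x => {yB BE}B; apply/idP/idP=> [yB|]; last first.
  by rewrite inE => /class_dyck_homo/dyck_leP; apply.
have [x'] := class_dyck_prime (class_dyck_meet xy yB).
rewrite J_meet in_setI inE jasm_le => /andP[le x'B] /xmin ge.
suff <- : x' = x by [].
move: le; rewrite tetra_leE /tetra_le => le.
by have := tetraP x; have := tetraP x' => *; apply: tetra_inj; lia.
Qed.

(** For [x] in m(A), [A] joined with [jasm x] leaves the class of the maximal [A], so some wall
    element [w y] lies below [x] outside J(A); minimality of [x] gives [w y = x]. *)
Lemma congruence_wall A : (forall B, e A B -> ~~ (A < B)%O) ->
  exists W : {set tetra n}, is_wall W /\ mset A \subset W.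
Proof.
move=> Amax; have [w wP] := fin_all_exists class_dyck_least.
exists [set w y | y in [set: triang n]]; split.
  exists w => // y z.
  (* This [B] represents the principal lower set of [z], so J(B) contains exactly the [w u] with
     [u <= z]. *)
  have [B BE] := class_dyck_surj (dyck_of [set z]).
  have inB u : (w u \in J B) = (u <= z)%O.
    rewrite -wP BE in_dyck_of; apply/exists_inP/idP=> [[v]|le].
      by rewrite inE => /eqP ->.
    by exists z; rewrite ?inE.
  rewrite -jasm_le; apply/idP/idP=> [le|le].
    rewrite -inB inE; apply: le_trans le _.
    by have := inB z; rewrite lexx inE.
  have : w z \in J (jasm (w z)) by rewrite inE lexx.
  by rewrite -wP => /(in_dyck_le le); rewrite wP inE.
apply/subsetP=> x; rewrite inE in_setC => /andP[xA /forallP xmin].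
have ltA : (A < A `|` jasm x)%O.
  by rewrite lt_neqAle leUl andbT; apply: contraNneq xA => AE; rewrite inE AE leUr.
have nle : ~~ (class_dyck (A `|` jasm x)%O <= class_dyck A)%O.
  apply: contraL ltA => le; apply: Amax; apply: class_dyck_inj.
  by apply/le_anti; rewrite le andbT class_dyck_homo // leUl.
have [/forallP all|] := boolP [forall y, (w y \in J (A `|` jasm x)%O) ==> (w y \in J A)].
  by case/negP: nle; apply/dyck_leP=> y; rewrite !wP; apply/implyP.
rewrite negb_forall => /existsP[y]; rewrite negb_imply J_join in_setU.
rewrite [w y \in J (jasm x)]inE jasm_le => /andP[/orP[-> //|le] wA].
apply/imsetP; exists y => //; apply/eqP; rewrite eq_sym; apply/negPn/negP=> ne.
have := xmin (w y); rewrite in_setC wA /= lt_neqAle le ne.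
by [].
Qed.

End CongruenceWall.

Theorem theorem5p8 (n : nat) (n_ge1 : (1 <= n)%N) (A : asm n) :
  [<-> exists s : 'S_n, asm_val A = perm_mx s /\ covexillary s;
       ~ exists i j k l : 'I_n.+1,
           [/\ ascent A i j, ascent A k l, (i < k)%N & (l < j)%N];
       eps_well_defined A /\ depth_antichain (mbar A) (eps_map A);
       eps_well_defined A /\
         (exists delta : triang n -> int,
            depth_triangle delta /\ {in mbar A, delta =1 eps_map A});
       exists W : {set tetra n}, is_wall W /\ mset A \subset W;
       exists e : equiv_rel (asm n),
         catalan_congruence e /\
         (forall B : asm n, e A B -> ~~ (A < B)%O)].
Proof.
tfae.
- by move=> [s [As cov]] /crossing_ascentsP; apply: covexillary_noncrossing As cov.
- move=> ncr; have ncr' : ~ crossing_ascents n (corner_sum A).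
    by move/crossing_ascentsP.
  by split; [apply: noncrossing_well_defined | apply: noncrossing_depth_antichain].
- by move=> [wd /depth_antichain_extends].
- by move=> [wd]; apply: depth_triangle_wall.
- exact: wall_maximal.
(* The cycle closes through a wall containing m(A) and the absence of crossing ascents. *)
- move=> [e [[eP [f f_bij f_le]] Amax]].
  exact/noncrossing_covexillary/wall_noncrossing/(congruence_wall eP f_bij f_le).
Qed.
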